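(* There exists a stochastic block model $\mathrm{SBM}(n;p,Q)$ (with the number of communities, $p$ and $Q$ allowed to depend on $n$) with the following properties. All Fourier coefficients $\Phi_{\mathrm{SBM}(p,Q)}(H)$ corresponding to graphs $H$ with at least one leaf (including all stars) are zero, and the Fourier coefficients corresponding to graphs with an odd number of edges (including triangles) are zero. Furthermore, the 4-cycle is the unique connected graph of constant size (with at least one edge) whose signed count can distinguish $\mathrm{SBM}(n;p,Q)$ and $\mathbb{G}(n,1/2)$ with high probability.
   Context: Graphs are finite, simple and undirected; a leaf is a vertex of degree one. $\mathbb{G}(n,1/2)$ is the Erdős–Rényi random graph. A stochastic block model on $k$ communities is given by a probability vector $p\in(0,1]^k$ and a symmetric matrix $Q\in[-1,1]^{k\times k}$. A sample $\mathbf{G}\sim\mathrm{SBM}(n;p,Q)$ is an $n$-vertex graph produced by drawing i.i.d. labels $\mathbf{x}_1,\dots,\mathbf{x}_n\in[k]$ with pmf $p$, and then including each edge $(i,j)$ independently with probability $(1+Q_{\mathbf{x}_i,\mathbf{x}_j})/2$. For a graph $H$ (placed on any $|V(H)|$ of the vertices), $\Phi_{\mathrm{SBM}(p,Q)}(H)=\mathbb{E}_{\mathbf{G}\sim\mathrm{SBM}(n;p,Q)}\big[\prod_{(i,j)\in E(H)}(2\mathbf{G}_{ij}-1)\big]$ (independent of the placement). The signed count of $H$ in an $n$-vertex graph $G$ is $\mathrm{SC}_H(G)=\sum_{H_1\sim H}\prod_{(i,j)\in E(H_1)}(2G_{ij}-1)$, the sum over all subgraphs $H_1$ of $K_n$ isomorphic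 to $H$. With $f=\mathrm{SC}_H$ and $M_n=\max(\mathrm{Var}_{\mathbb{G}(n,1/2)}[f]^{1/2},\mathrm{Var}_{\mathbb{P}_n}[f]^{1/2})$, the signed count of $H$ distinguishes $\mathbb{P}_n$ from $\mathbb{G}(n,1/2)$ (with high probability) if $|\mathbb{E}_{\mathbb{P}_n}f-\mathbb{E}_{\mathbb{G}(n,1/2)}f|=\omega(M_n)$, and it fails to distinguish if $|\mathbb{E}_{\mathbb{P}_n}f-\mathbb{E}_{\mathbb{G}(n,1/2)}f|=o(M_n)$, as $n\to\infty$. Uniqueness means that every other connected graph of constant size fails. *)

(* Defs.v *)
From HB Require Import structures.
From mathcomp Require Import all_boot all_order all_algebra.
From mathcomp Require Import all_classical all_reals all_analysis.

Set Implicit Arguments.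
Unset Strict Implicit.
Unset Printing Implicit Defensive.

Import Order.TTheory GRing.Theory Num.Theory numFieldNormedType.Exports.

Local Open Scope ring_scope.

Definition simple_adj n (g : {ffun 'I_n * 'I_n -> bool}) : bool :=
  [forall i, ~~ g (i, i)] && [forall i, forall j, g (i, j) == g (j, i)].

Record sgraph (n : nat) := SGraph {
  sgraph_ffun : {ffun 'I_n * 'I_n -> bool};
  _ : simple_adj sgraph_ffun }.

HB.instance Definition _ n := [isSub for @sgraph_ffun n].
HB.instance Definition _ n := [Finite of sgraph n by <:].

Definition adj n (G : sgraph n) : rel 'I_n := fun i j => sgraph_ffun G (i, j).

(* Each edge is listed once, with its endpoints in increasing order. *)
Definition edges n (G : sgraph n) : {set 'I_n * 'I_n} :=
  [set e : 'I_n * 'I_n | (e.1 < e.2)%N && adj G e.1 e.2].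

Definition deg n (G : sgraph n) (v : 'I_n) : nat := #|[set w | adj G v w]|.

Definition has_leaf n (G : sgraph n) : Prop := exists v, deg G v = 1%N.

Definition connected_graph n (G : sgraph n) : Prop :=
  (0 < n)%N /\ forall u v, connect (adj G) u v.

Definition isomorphic m n (G : sgraph m) (H : sgraph n) : Prop :=
  exists2 f : 'I_m -> 'I_n,
    bijective f & forall i j, adj H (f i) (f j) = adj G i j.

Definition c4_ffun : {ffun 'I_4 * 'I_4 -> bool} :=
  [ffun e : 'I_4 * 'I_4 =>
    (e.2 == e.1.+1 %[mod 4])%N || (e.1 == e.2.+1 %[mod 4])%N].

Lemma c4_simple : simple_adj c4_ffun.
Proof.
apply/andP; split; first by apply/forallP => -[[|[|[|[|i]]]] // ?]; rewrite ffunE.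
by apply/forallP => i; apply/forallP => j; rewrite !ffunE /= orbC.
Qed.

Definition C4 : sgraph 4 := SGraph c4_simple.

(* A subgraph of K_n is a vertex set S.1 together with an edge relation S.2
   whose edges all have their endpoints in S.1. *)
Definition subgraph_iso m n (H : sgraph m) (S : {set 'I_n} * sgraph n) : bool :=
  [forall i, forall j, adj S.2 i j ==> (i \in S.1) && (j \in S.1)] &&
  [exists f : {ffun 'I_m -> 'I_n},
    [&& injectiveb f, [set f a | a : 'I_m] == S.1 &
        [forall a, forall b, adj S.2 (f a) (f b) == adj H a b]]].

Section RandomGraphs.
Variable R : realType.

Definition edge_sign n (G : sgraph n) (i j : 'I_n) : R :=
  2 * (adj G i j)%:R - 1.

Definition signed_count m (H : sgraph m) n (G : sgraph n) : R :=
  \sum_(S : {set 'I_n} * sgraph n | subgraph_iso H S)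
    \prod_(e in edges S.2) edge_sign G e.1 e.2.

(* Each edge {i, j} is present independently with probability W i j; only the
   values with i < j are used. *)
Definition indep_edges_pmf n (W : 'I_n -> 'I_n -> R) (G : sgraph n) : R :=
  \prod_(e : 'I_n * 'I_n | (e.1 < e.2)%N)
    (if adj G e.1 e.2 then W e.1 e.2 else 1 - W e.1 e.2).

Definition gnp_pmf n (q : R) (G : sgraph n) : R :=
  indep_edges_pmf (fun _ _ => q) G.

Record sbm := SBM {
  sbm_k : nat;
  sbm_p : 'I_sbm_k -> R;
  sbm_Q : 'M[R]_sbm_k;
  sbm_p_itv : forall a, 0 < sbm_p a <= 1;
  sbm_p_sum : \sum_a sbm_p a = 1;
  sbm_Q_sym : sbm_Q^T = sbm_Q;
  sbm_Q_itv : forall a b, -1 <= sbm_Q a b <= 1 }.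

Definition sbm_pmf (M : sbm) n (G : sgraph n) : R :=
  \sum_(x : {ffun 'I_n -> 'I_(sbm_k M)})
    (\prod_i sbm_p (x i)) *
    indep_edges_pmf (fun i j => (1 + sbm_Q M (x i) (x j)) / 2) G.

Definition pmf_mean n (mu : sgraph n -> R) (f : sgraph n -> R) : R :=
  \sum_G mu G * f G.

Definition pmf_var n (mu : sgraph n -> R) (f : sgraph n -> R) : R :=
  pmf_mean mu (fun G => (f G - pmf_mean mu f) ^+ 2).

(* The Fourier coefficient of H, placed on the vertices of an N-vertex sample
   by the injection f. *)
Definition fourier (M : sbm) m (H : sgraph m) N (f : 'I_m -> 'I_N) : R :=
  pmf_mean (@sbm_pmf M N)
    (fun G => \prod_(e in edges H) edge_sign G (f e.1) (f e.2)).

Section Distinguish.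
Local Open Scope classical_set_scope.
Variables (P : forall n, sgraph n -> R) (m : nat) (H : sgraph m).

Definition mean_gap : nat -> R^o := fun n =>
  pmf_mean (@P n) (@signed_count m H n) -
  pmf_mean (@gnp_pmf n (1 / 2)) (@signed_count m H n).

Definition max_std : nat -> R^o := fun n =>
  Num.max (Num.sqrt (pmf_var (@gnp_pmf n (1 / 2)) (@signed_count m H n)))
          (Num.sqrt (pmf_var (@P n) (@signed_count m H n))).

Definition distinguishes : Prop :=
  forall C : R, 0 < C -> \forall n \near \oo, C * max_std n < `|mean_gap n|.

Definition fails_to_distinguish : Prop := mean_gap =o_\oo max_std.

End Distinguish.
End RandomGraphs.

(* Main.v *)
Require Import Defs.
From mathcomp Require Import all_boot all_order all_algebra.
From mathcomp Require Import all_classical all_reals all_analysis.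
From mathcomp Require Import ring lra zify.

(** The labels split into [2k] equally likely blocks; a block carries a sign
    [s], and every label a further sign [u].  The bias is [Q = q s u u'] inside
    a block and [0] between blocks.  Flipping [u] at one vertex shows that a
    graph with a vertex of odd degree has zero coefficient; flipping [s]
    everywhere does the same for an odd number of edges.  A connected graph
    needs all its labels in one block, so [|Phi(H)| <= q^e (2k)^(1-v)], with
    equality for the 4-cycle.

    Take [q = j^4 / sqrt n] and [k = j^5] with [j] growing more slowly than any
    power of [n].  The gap is the number of copies, at most [n^v], times
    [Phi(H)], and the null standard deviation is at least the square root of
    that number, so [H] fails once [n^(v/2) |Phi(H)|] tends to zero.  A connected
    graph without leaves has [e >= v].  If [e > v] then [n^(v/2) q^e] is at most
    [j^(4e) / sqrt n]; if [e = v >= 6] the quantity is at most [j^(5-v)]; and if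
    [e = v] is even and smaller than 6 the graph is the 4-cycle.

    For the 4-cycle the gap is of order [n^2 j].  In the planted variance,
    vertex-disjoint pairs of copies are uncorrelated, and two distinct copies
    sharing [r >= 1] vertices share at most [r - 1] edges, so their covariance
    is at most [q^(10 - 2r)]; summing over pairs gives [O(n^4)]. *)

Set Implicit Arguments.
Unset Strict Implicit.
Unset Printing Implicit Defensive.

Import Order.TTheory GRing.Theory Num.Theory numFieldNormedType.Exports.

(** * Edge sets, degrees, and copies of a graph inside a larger vertex set *)

Section Graphs.

Lemma adj_sym n (G : sgraph n) i j : adj G i j = adj G j i.
Proof.
rewrite /adj; case: G => g /= /andP[_ /forallP h].
by have /forallP/(_ j)/eqP := h i.
Qed.

Lemma adj_irr n (G : sgraph n) i : adj G i i = false.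
Proof.
rewrite /adj; case: G => g /= /andP[/forallP h _].
exact/negbTE/h.
Qed.

Lemma in_edges n (G : sgraph n) e :
  (e \in edges G) = (e.1 < e.2)%N && adj G e.1 e.2.
Proof. by rewrite inE. Qed.

Lemma sgraph_eq n (G G' : sgraph n) : adj G =2 adj G' -> G = G'.
Proof. by move=> h; apply/val_inj/ffunP => -[i j]; exact: h. Qed.

Lemma edges_inj n : injective (@edges n).
Proof.
move=> G G' h; apply: sgraph_eq => i j.
have lt_case (a b : 'I_n) : (a < b)%N -> adj G a b = adj G' a b.
  by move=> ab; have := congr1 (fun A : {set _} => (a, b) \in A) h;
    rewrite !in_edges /= ab.
have [ij|ji|/ord_inj ->] := ltngtP i j; last by rewrite !adj_irr.
  exact: lt_case.
by rewrite adj_sym [RHS]adj_sym; exact: lt_case.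
Qed.

(** Counting by incidences makes the degree the exponent of [-1] that appears when a sign at [v] is
    flipped in a product over edges. *)
Lemma deg_incident n (G : sgraph n) v :
  deg G v = \sum_(e in edges G) ((e.1 == v) + (e.2 == v)).
Proof.
have -> : deg G v = \sum_j adj G v j by rewrite /deg -sum1dep_card big_mkcond.
rewrite [RHS]big_mkcond /=.
rewrite [RHS](eq_bigr (fun e : 'I_n * 'I_n =>
    ((e.1 < e.2) && adj G e.1 e.2) * ((e.1 == v) + (e.2 == v))))%N; last first.
  by move=> e _; rewrite in_edges; case: ifP; rewrite ?mul1n ?mul0n.
rewrite -(pair_bigA _ (fun i j : 'I_n => ((i < j) && adj G i j) * ((i == v) + (j == v))))%N /=.
under [RHS]eq_bigr do (under eq_bigr do rewrite mulnDr; rewrite big_split).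
rewrite big_split /= [X in (_ + X)%N]exchange_big /=.
rewrite [X in _ = (X + _)%N](bigD1 v) //= [X in _ = (_ + X + _)%N]big1 ?addn0; last first.
  by move=> i /negbTE ->; apply: big1 => j _; rewrite muln0.
rewrite [X in _ = (_ + X)%N](bigD1 v) //= [X in _ = (_ + (_ + X))%N]big1 ?addn0; last first.
  by move=> i /negbTE ->; apply: big1 => j _; rewrite muln0.
rewrite -big_split /=; apply: eq_bigr => j _; rewrite eqxx !muln1 (adj_sym G j v).
by have [||/ord_inj ->] := ltngtP v j; rewrite ?adj_irr ?addn0.
Qed.

Lemma deg_sum n (G : sgraph n) : \sum_v deg G v = (2 * #|edges G|)%N.
Proof.
under eq_bigr do rewrite deg_incident.
rewrite exchange_big /= -sum1_card big_distrr /=; apply: eq_bigr => e _.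
rewrite big_split /= (bigD1 e.1) //= big1 ?eqxx => [|v /negbTE]; last first.
  by rewrite eq_sym => ->.
rewrite (bigD1 e.2) //= big1 ?eqxx // => v /negbTE.
by rewrite eq_sym => ->.
Qed.

(** An injection need not preserve the order of endpoints, so the image pair is sorted again to be a
    valid member of an edge set. *)
Definition place m n (f : 'I_m -> 'I_n) (e : 'I_m * 'I_m) : 'I_n * 'I_n :=
  if (f e.1 < f e.2)%N then (f e.1, f e.2) else (f e.2, f e.1).

Lemma place_inj m n (H : sgraph m) (f : 'I_m -> 'I_n) :
  injective f -> {in edges H &, injective (place f)}.
Proof.
move=> fi [a b] [c d]; rewrite !in_edges /place /= => /andP[ab _] /andP[cd _].
case: ifP => _; case: ifP => _ [/fi e1 /fi e2]; subst => //.
  by have := ltn_trans ab cd; rewrite ltnn.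
by have := ltn_trans ab cd; rewrite ltnn.
Qed.

Lemma place_lt m n (H : sgraph m) (f : 'I_m -> 'I_n) :
  injective f -> {in edges H, forall e, ((place f e).1 < (place f e).2)%N}.
Proof.
move=> fi [a b]; rewrite in_edges /place /= => /andP[ab _].
have [//|//|/ord_inj/fi abE] := ltngtP (f a) (f b).
by move: ab; rewrite abE ltnn.
Qed.

Lemma big_place (R : comPzSemiRingType) m n (H : sgraph m) (f : 'I_m -> 'I_n)
    (F : 'I_n -> 'I_n -> R) :
  injective f -> (forall i j, F i j = F j i) ->
  (\prod_(e in place f @: edges H) F e.1 e.2 =
   \prod_(e in edges H) F (f e.1) (f e.2))%R.
Proof.
move=> fi Fs; rewrite big_imset /=; last exact: place_inj.
by apply: eq_bigr => e _; rewrite /place; case: ifP.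
Qed.

(** Describing a copy by its edge set, and not by adjacency, lets a product over its edges be pulled
    back to [H] with [big_place]. *)
Definition embeds m n (H : sgraph m) (S : {set 'I_n} * sgraph n)
    (f : {ffun 'I_m -> 'I_n}) :=
  [/\ injective f, S.1 = f @: 'I_m & edges S.2 = place f @: edges H].

Lemma subgraph_isoP m n (H : sgraph m) (S : {set 'I_n} * sgraph n) :
  reflect (exists f, embeds H S f) (subgraph_iso H S).
Proof.
apply: (iffP andP) => [[/forallP hV]|[f [fi im hE]]].
  move=> /existsP[f /and3P[/injectiveP fi /eqP im /forallP hE]].
  have adjE a b : adj S.2 (f a) (f b) = adj H a b.
    by have /forallP/(_ b)/eqP := hE a.
  exists f; split => //.
  apply/setP => -[i j]; apply/idP/imsetP => [|[[a b]]].
    rewrite in_edges /= => /andP[ij aij].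
    have /forallP/(_ j) := hV i; rewrite aij /= -im => /andP[/imsetP[a _ ia] /imsetP[b _ jb]].
    subst i j; rewrite adjE in aij.
    have [ab|ba|/ord_inj abE] := ltngtP a b.
    - by exists (a, b); rewrite ?in_edges /= ?ab // /place /= ij.
    - exists (b, a); rewrite ?in_edges /= ?ba 1?adj_sym // /place /=.
      by rewrite ltnNge (ltnW ij).
    - by rewrite abE ltnn in ij.
  rewrite [(a, b) \in _]in_edges /place /= => /andP[ab aab].
  have [lt [-> ->]|lt [-> ->]|/ord_inj/fi abE] := ltngtP (f a) (f b); rewrite ?in_edges /=.
  - by rewrite lt adjE.
  - by rewrite lt adj_sym adjE.
  - by rewrite abE ltnn in ab.
have adjlt a b : (f a < f b)%N -> adj S.2 (f a) (f b) = adj H a b.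
  move=> lt; have -> : adj S.2 (f a) (f b) = ((f a, f b) \in edges S.2) by rewrite in_edges lt.
  rewrite hE; apply/imsetP/idP => [[[c d]]|aab].
    rewrite in_edges /place /= => /andP[cd acd].
    by case: ifP => _ [/fi -> /fi ->] //; rewrite adj_sym.
  have [ab|ba|/ord_inj abE] := ltngtP a b.
  - by exists (a, b); rewrite ?in_edges /= ?ab // /place /= lt.
  - exists (b, a); rewrite ?in_edges /= ?ba 1?adj_sym // /place /=.
    by rewrite ltnNge (ltnW lt).
  - by rewrite abE ltnn in lt.
have adjE a b : adj S.2 (f a) (f b) = adj H a b.
  have [ab|ba|/ord_inj/fi ->] := ltngtP (f a) (f b); last by rewrite !adj_irr.
    exact: adjlt.
  by rewrite adj_sym [RHS]adj_sym; exact: adjlt.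
split.
  have lt_in (i j : 'I_n) : (i < j)%N -> adj S.2 i j -> (i \in S.1) /\ (j \in S.1).
    move=> ij aij; have : (i, j) \in edges S.2 by rewrite in_edges ij.
    rewrite hE im => /imsetP[[a b] _]; rewrite /place /=.
    by case: ifP => _ [-> ->]; rewrite !imset_f.
  apply/forallP => i; apply/forallP => j; apply/implyP => aij; apply/andP.
  have [ij|ji|/ord_inj ijE] := ltngtP i j; last by rewrite ijE adj_irr in aij.
    exact: lt_in.
  by rewrite adj_sym in aij; have [] := lt_in _ _ ji aij.
apply/existsP; exists f; apply/and3P; split; first exact/injectiveP.
  by apply/eqP; rewrite im.
by apply/forallP => a; apply/forallP => b; rewrite adjE.
Qed.
End Graphs.

(** * Counting copies of a graph *)

Section Copies.

Definition edge_ffun n (E : {set 'I_n * 'I_n}) : {ffun 'I_n * 'I_n -> bool} :=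
  [ffun e : 'I_n * 'I_n =>
    ((e.1 < e.2) && (e \in E)) || ((e.2 < e.1) && ((e.2, e.1) \in E))]%N.

Lemma edge_ffun_simple n (E : {set 'I_n * 'I_n}) : simple_adj (edge_ffun E).
Proof.
apply/andP; split; first by apply/forallP => i; rewrite ffunE /= ltnn.
by apply/forallP => i; apply/forallP => j; rewrite !ffunE /= orbC.
Qed.

Definition graph_of n (E : {set 'I_n * 'I_n}) : sgraph n :=
  SGraph (edge_ffun_simple E).

Lemma edges_graph_of n (E : {set 'I_n * 'I_n}) :
  edges (graph_of E) = E :&: [set e : 'I_n * 'I_n | (e.1 < e.2)%N].
Proof.
apply/setP => -[i j]; rewrite in_edges !inE /adj /= ffunE /= andbC.
by case: ltngtP; rewrite ?andbF ?andbT ?orbF.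
Qed.

Lemma embeds_graph_of m n (H : sgraph m) (f : {ffun 'I_m -> 'I_n}) :
  injective f -> embeds H (f @: 'I_m, graph_of (place f @: edges H)) f.
Proof.
move=> fi; split => //=; rewrite edges_graph_of.
by apply/finset.setIidPl/fintype.subsetP => _ /imsetP[e eH ->]; rewrite inE (place_lt fi eH).
Qed.

Lemma embeds_inj m n (H : sgraph m) S S' (f : {ffun 'I_m -> 'I_n}) :
  embeds H S f -> embeds H S' f -> S = S'.
Proof.
by case: S S' => V G [V' G'] [_ /= -> e1] [_ /= -> e2]; congr pair; apply/edges_inj; rewrite e1.
Qed.

(** Every copy has an embedding and an embedding determines its copy, so passing from copies to all
    maps only adds nonnegative terms. Sums over maps are easier because they factor over the
    vertices of [H]. *)
Lemma sum_copies_le (R : realDomainType) m n (H : sgraph m)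
    (P : pred ({set 'I_n} * sgraph n))
    (F : {set 'I_n} * sgraph n -> R) (g : {ffun 'I_m -> 'I_n} -> R) :
  (forall f, 0 <= g f)%R ->
  (forall S f, P S -> embeds H S f -> F S <= g f)%R ->
  (\sum_(S | subgraph_iso H S && P S) F S <= \sum_f g f)%R.
Proof.
move=> g0 Fg.
apply: (@le_trans _ _ (\sum_(S | subgraph_iso H S && P S)
    \sum_(f | `[< embeds H S f >]) g f)%R).
  apply: ler_sum => S /andP[/subgraph_isoP[f Sf] PS].
  rewrite (bigD1 f) /=; last exact/asboolP.
  apply: (le_trans (Fg _ _ PS Sf)); rewrite lerDl; exact: sumr_ge0.
rewrite (exchange_big_dep xpredT) //=; apply: ler_sum => f _.
rewrite sumr_const -[leRHS]mulr1n ler_wpMn2l ?g0 //.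
apply/card_le1_eqP => S S'; rewrite /in_mem /=.
by move=> /andP[_ /asboolP Sf] /andP[_ /asboolP Sf']; exact: embeds_inj Sf' Sf.
Qed.

Definition num_copies m (H : sgraph m) n : nat :=
  #|[pred S : {set 'I_n} * sgraph n | subgraph_iso H S]|.

Lemma num_copies_le m (H : sgraph m) n : (num_copies H n <= n ^ m)%N.
Proof.
have := @sum_copies_le int m n H xpredT (fun=> 1%R) (fun=> 1%R).
rewrite !sumr_const card_ffun !card_ord ler_nat /num_copies => h.
have -> : #|[pred S : {set 'I_n} * sgraph n | subgraph_iso H S]| =
   #|[pred S : {set 'I_n} * sgraph n | subgraph_iso H S && xpredT S]|.
  by apply: eq_card => S; rewrite !inE andbT.
by apply: h.
Qed.

(* Vertex [i] of [H] goes to the residue class of [i] modulo [m], so the image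
   of such a placement determines the placement. *)
Lemma num_copies_ge m (H : sgraph m) n : ((n %/ m) ^ m <= num_copies H n)%N.
Proof.
have lt_n (a : {ffun 'I_m -> 'I_(n %/ m)}) (i : 'I_m) : (a i * m + i < n)%N.
  have := leq_divM n m; have := ltn_ord (a i); have := ltn_ord i; nia.
pose f a : {ffun 'I_m -> 'I_n} := [ffun i => Ordinal (lt_n a i)].
have fK a a' i j : f a i = f a' j -> i = j /\ a i = a' j.
  rewrite !ffunE => /(congr1 val) /= e.
  have ij : i = j :> nat.
    by have := congr1 (modn^~ m) e; rewrite !modnMDl !modn_small.
  split; first exact: ord_inj.
  apply: ord_inj; move: e; rewrite ij; have := ltn_ord j; nia.
have fi a : injective (f a) by move=> i j /fK[].
pose S a := (f a @: 'I_m, graph_of (place (f a) @: edges H)).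
have Si : injective S.
  move=> a a' [/setP e _]; apply/ffunP => i.
  have : f a i \in f a @: 'I_m by apply: imset_f.
  by rewrite e => /imsetP[j _ /fK[-> ->]].
rewrite -{1}(card_ord (n %/ m)) -[X in (_ ^ X)%N](card_ord m) -card_ffun.
rewrite -(card_codom Si); apply: subset_leq_card.
apply/fintype.subsetP => _ /codomP[a ->]; rewrite inE.
by apply/subgraph_isoP; exists (f a); exact: embeds_graph_of.
Qed.
End Copies.

(** * Means of products of edge signs *)

Section Expectation.
Local Open Scope ring_scope.
Variable R : realType.

Lemma indep_edges_mean n (W : 'I_n -> 'I_n -> R) (E : {set 'I_n * 'I_n}) :
  {in E, forall e : 'I_n * 'I_n, (e.1 < e.2)%N} ->
  pmf_mean (indep_edges_pmf W) (fun G => \prod_(e in E) edge_sign R G e.1 e.2) =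
  \prod_(e in E) (2 * W e.1 e.2 - 1).
Proof.
move=> Elt.
have ltE (F : 'I_n * 'I_n -> R) : \prod_(e in E) F e =
    \prod_(e : 'I_n * 'I_n | (e.1 < e.2)%N) (if e \in E then F e else 1).
  rewrite -big_mkcondr; apply: eq_bigl => e.
  by case: (boolP (e \in E)) => [/Elt ->|]; rewrite ?andbF.
pose F (e : 'I_n * 'I_n) (b : bool) : R := (if b then W e.1 e.2 else 1 - W e.1 e.2) *
  (if e \in E then 2 * b%:R - 1 else 1).
transitivity (\sum_G \prod_(e : 'I_n * 'I_n | (e.1 < e.2)%N) F e (adj G e.1 e.2)).
  by apply: eq_bigr => G _; rewrite ltE -big_split.
transitivity (\prod_(e : 'I_n * 'I_n | (e.1 < e.2)%N) \sum_b F e b); last first.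
  rewrite ltE; apply: eq_bigr => e _; rewrite big_bool /F /=.
  by case: ifP => _; ring.
rewrite (big_distr_big_dep false) /=.
(* Expanding the product of sums yields Boolean functions that are [false] off the increasing pairs;
   [h] and [h'] match them with graphs. *)
pose h (G : sgraph n) : {ffun 'I_n * 'I_n -> bool} :=
  [ffun e : 'I_n * 'I_n => (e.1 < e.2)%N && adj G e.1 e.2].
pose h' (g : {ffun 'I_n * 'I_n -> bool}) := graph_of [set e | g e].
have adjh' g (i j : 'I_n) : (i < j)%N -> adj (h' g) i j = g (i, j).
  by move=> ij; rewrite /adj ffunE /= !inE ij ltnNge (ltnW ij) /= orbF.
rewrite [RHS](reindex_onto h h') /=; last first.
  move=> g /pfamilyP[/fintype.subsetP sg _]; apply/ffunP => -[i j]; rewrite ffunE /=.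
  have [ij|ij] /= := boolP (i < j)%N; first by rewrite adjh'.
  by apply/esym; apply: contraNF ij => gij; apply: (sg (i, j)); rewrite inE gij.
apply: eq_big => [G|G _].
  apply/esym/andP; split.
    apply/pfamilyP; split; last by [].
    apply/fintype.subsetP => -[i j]; rewrite !unfold_in /= ffunE /=; by case: (i < j)%N.
  apply/eqP/edges_inj; rewrite edges_graph_of; apply/setP => -[i j].
  by rewrite in_edges !inE ffunE /= andbC andbA andbb.
by apply: eq_bigr => e elt; rewrite ffunE elt.
Qed.

(** Given the labels, the edges are independent and the sign of an edge has mean
    [2 * ((1 + Q) / 2) - 1], which is [Q]. *)
Lemma sbm_mean (M : sbm R) n (E : {set 'I_n * 'I_n}) :
  {in E, forall e : 'I_n * 'I_n, (e.1 < e.2)%N} ->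
  pmf_mean (@sbm_pmf R M n) (fun G => \prod_(e in E) edge_sign R G e.1 e.2) =
  \sum_(x : {ffun 'I_n -> 'I_(sbm_k M)}) (\prod_i sbm_p (x i)) *
    \prod_(e in E) sbm_Q M (x e.1) (x e.2).
Proof.
move=> Elt; rewrite /pmf_mean /sbm_pmf.
under eq_bigr do rewrite mulr_suml.
rewrite exchange_big /=; apply: eq_bigr => x _.
under eq_bigr do rewrite -mulrA.
rewrite -mulr_sumr; congr (_ * _).
rewrite [LHS](indep_edges_mean _ Elt); apply: eq_bigr => e _.
by field.
Qed.
End Expectation.

(** * Averages over random labels *)

Section LabelMean.
Local Open Scope ring_scope.
Variable R : realType.

Definition label_mean (M : sbm R) n (F : {ffun 'I_n -> 'I_(sbm_k M)} -> R) : R :=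
  \sum_(x : {ffun 'I_n -> 'I_(sbm_k M)}) (\prod_i sbm_p (x i)) * F x.

Section Basic.
Variables (M : sbm R) (n : nat).
Implicit Types F G : {ffun 'I_n -> 'I_(sbm_k M)} -> R.

Lemma label_weight_ge0 (x : {ffun 'I_n -> 'I_(sbm_k M)}) : 0 <= \prod_i sbm_p (x i) :> R.
Proof. by apply: prodr_ge0 => i _; case/andP: (sbm_p_itv (x i)) => /ltW. Qed.

Lemma label_mean_prod (h : 'I_n -> 'I_(sbm_k M) -> R) :
  label_mean (fun x => \prod_v h v (x v)) = \prod_v \sum_a sbm_p a * h v a.
Proof. by rewrite bigA_distr_bigA; apply: eq_bigr => x _; rewrite -big_split. Qed.

Lemma label_mean1 : label_mean (fun=> 1 : R) (M := M) (n := n) = 1.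
Proof.
have := label_mean_prod (fun _ _ => 1); rewrite [RHS]big1 => [h|i _].
  rewrite -[RHS]h; by apply: eq_bigr => x _; rewrite big1_eq.
by under eq_bigr do rewrite mulr1; exact: sbm_p_sum.
Qed.

Lemma ler_label_mean F G : (forall x, F x <= G x) -> label_mean F <= label_mean G.
Proof. by move=> FG; apply: ler_sum => x _; rewrite ler_wpM2l ?label_weight_ge0. Qed.

Lemma ler_norm_label_mean F : `|label_mean F| <= label_mean (fun x => `|F x|).
Proof.
apply: (le_trans (ler_norm_sum _ _ _)); apply: ler_sum => x _.
by rewrite normrM ger0_norm ?label_weight_ge0.
Qed.

Lemma label_meanZ c F : label_mean (fun x => c * F x) = c * label_mean F.
Proof. by rewrite /label_mean mulr_sumr; apply: eq_bigr => x _; rewrite mulrCA. Qed.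

Lemma label_mean_sum (I : finType) (P : pred I) (F : I -> {ffun 'I_n -> 'I_(sbm_k M)} -> R) :
  label_mean (fun x => \sum_(i | P i) F i x) = \sum_(i | P i) label_mean (F i).
Proof. by rewrite /label_mean exchange_big /=; apply: eq_bigr => x _; rewrite mulr_sumr. Qed.

Lemma label_mean_cst c : label_mean (fun=> c) (M := M) (n := n) = c.
Proof.
by have := label_meanZ c (fun=> 1); rewrite label_mean1 mulr1. Qed.

End Basic.

Lemma edge_sign_sym n (G : sgraph n) i j : edge_sign R G i j = edge_sign R G j i.
Proof. by rewrite /edge_sign adj_sym. Qed.

Lemma sbm_Q_symE (M : sbm R) a b : sbm_Q M a b = sbm_Q M b a.
Proof. by rewrite -[in LHS](sbm_Q_sym M) mxE. Qed.

(** Injectivity sends distinct edges of [H] to distinct edges of the sample, so conditional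
    independence applies edge by edge. *)
Lemma fourierE (M : sbm R) m (H : sgraph m) n (f : 'I_m -> 'I_n) :
  injective f ->
  fourier M H f =
  label_mean (fun x => \prod_(e in edges H) sbm_Q M (x (f e.1)) (x (f e.2))).
Proof.
move=> fi; transitivity (pmf_mean (@sbm_pmf R M n)
    (fun G => \prod_(e in place f @: edges H) edge_sign R G e.1 e.2)).
  apply: eq_bigr => G _; rewrite (big_place _ fi) //; exact: edge_sign_sym.
rewrite sbm_mean; last by move=> _ /imsetP[e eH ->]; exact: (place_lt fi eH).
apply: eq_bigr => x _.
rewrite (@big_place _ _ _ H f (fun i j => sbm_Q M (x i) (x j)) fi) // => i j.
exact: sbm_Q_symE.
Qed.
End LabelMean.

(** * The block model and its vanishing coefficients *)

Section BlockModel.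
Local Open Scope ring_scope.
Variable R : realType.
Variable k : nat.

(** A label is an index, the sign [s] and the sign [u]. The block is the index together with [s], so
    there are [2 * k.+1] blocks, half of each sign, and each holds two labels. *)
Definition label : finType := (('I_k.+1 * bool) * bool)%type.
Notation K := #|label|.

Definition block (a : 'I_K) := (enum_val a).1.
Definition bsgn (a : 'I_K) : R := (-1) ^+ (block a).2.
Definition vsgn (a : 'I_K) : R := (-1) ^+ (enum_val a).2.

Definition block_Q (q : R) : 'M[R]_K :=
  \matrix_(a, b) (q * (block a == block b)%:R * bsgn a * (vsgn a * vsgn b)).

Lemma card_label : K = (2 * (2 * k.+1))%N.
Proof. by rewrite !card_prod card_bool card_ord; lia. Qed.

Lemma block_p_itv (a : 'I_K) : 0 < (K%:R^-1 : R) <= 1.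
Proof.
have K0 : (0 < K)%N by rewrite card_label.
by rewrite invr_gt0 ltr0n K0 invf_le1 ?ltr0n // ler1n.
Qed.

Lemma block_p_sum : \sum_(a < K) (K%:R^-1 : R) = 1.
Proof.
rewrite sumr_const card_ord -[_ *+ K]mulr_natr mulVf //.
by rewrite pnatr_eq0 card_label.
Qed.

Lemma block_Q_sym q : (block_Q q)^T = block_Q q.
Proof.
apply/matrixP => a b; rewrite !mxE eq_sym.
case: eqP => [e|]; last by rewrite !mulr0 !mul0r.
by rewrite /bsgn e [vsgn b * _]mulrC.
Qed.

Lemma norm_block_Q q a b : 0 <= q -> `|block_Q q a b| = q * (block a == block b)%:R.
Proof.
move=> q0; rewrite mxE !normrM /bsgn /vsgn !normrX normrN1 !expr1n !mulr1.
by rewrite ger0_norm // ger0_norm ?ler0n.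
Qed.

Lemma norm_block_Q_le q a b : 0 <= q -> `|block_Q q a b| <= q.
Proof.
by move=> q0; rewrite norm_block_Q //; case: eqP; rewrite ?mulr1 ?mulr0.
Qed.

Lemma block_Q_itv q : 0 <= q <= 1 -> forall a b, -1 <= block_Q q a b <= 1.
Proof.
move=> /andP[q0 q1] a b; rewrite -ler_norml.
exact: le_trans (norm_block_Q_le _ _ q0) q1.
Qed.

Definition block_sbm (q : R) (hq : 0 <= q <= 1) : sbm R :=
  SBM block_p_itv block_p_sum (block_Q_sym q) (block_Q_itv hq).

Lemma block_freq (c : 'I_k.+1 * bool) :
  \sum_(a < K) K%:R^-1 * (block a == c)%:R = ((2 * k.+1)%:R^-1 : R).
Proof.
rewrite (eq_bigr (fun a : 'I_K => (fun t : label => K%:R^-1 * (t.1 == c)%:R) (enum_val a))) //.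
rewrite -(big_enum_val (A := predT) (fun t : label => K%:R^-1 * (t.1 == c)%:R)) /=.
rewrite -mulr_sumr.
rewrite -(pair_bigA _ (fun (d : 'I_k.+1 * bool) (u : bool) => (d == c)%:R)) /=.
rewrite (bigD1 c) //= [X in _ + X]big1 => [|d /negbTE ->]; last by rewrite big1_eq.
rewrite eqxx sumr_const card_bool addr0 card_label natrM invfM mulrAC mulVf ?mul1r //.
Qed.

(** An injective self-map of a finite set permutes it. The weights are uniform, so the mean equals
    its own negative. *)
Lemma sign_reversal_mean n (p : R) (F : {ffun 'I_n -> 'I_K} -> R) theta :
  injective theta -> (forall x, F (theta x) = - F x) ->
  \sum_(x : {ffun 'I_n -> 'I_K}) (\prod_(i < n) p) * F x = 0.
Proof.
move=> ti Ft; rewrite -mulr_sumr; apply/eqP; rewrite mulf_eq0; apply/orP; right.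
set S := \sum_x F x; have : S = - S.
  by rewrite {1}/S (reindex_inj ti) /= -sumrN; apply: eq_bigr.
by move=> h; apply/eqP; lra.
Qed.

Section Flip.
Variable tau : label -> label.
Hypothesis tauK : involutive tau.
Definition flip_label (a : 'I_K) : 'I_K := enum_rank (tau (enum_val a)).
Lemma flip_labelK : involutive flip_label.
Proof. by move=> a; rewrite /flip_label enum_rankK tauK enum_valK. Qed.
End Flip.

Variables (q : R) (hq : 0 <= q <= 1).
Notation M := (block_sbm hq).

Lemma fourier_leaf m (H : sgraph m) n (f : 'I_m -> 'I_n) :
  has_leaf H -> injective f -> fourier M H f = 0.
Proof.
move=> [v dv] fi; rewrite fourierE //.
pose tau (t : label) : label := (t.1, ~~ t.2).
have tauK : involutive tau by case=> b s; rewrite /tau /= negbK.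
pose theta (x : {ffun 'I_n -> 'I_K}) : {ffun 'I_n -> 'I_K} :=
  [ffun i => if i == f v then flip_label tau (x i) else x i].
apply: (@sign_reversal_mean n _ _ theta).
  apply: can_inj (theta) _ => x; apply/ffunP => i; rewrite !ffunE.
  by case: eqP => // _; rewrite flip_labelK.
move=> x.
(* The exponent counts the endpoints equal to [v]; over all edges it adds up to the degree of [v],
   which is one at a leaf. *)
have step i j : block_Q q (theta x (f i)) (theta x (f j)) =
    (-1) ^+ ((i == v) + (j == v)) * block_Q q (x (f i)) (x (f j)).
  have bE a : block (flip_label tau a) = block a by rewrite /block enum_rankK.
  have vE a : vsgn (flip_label tau a) = - vsgn a.
    by rewrite /vsgn enum_rankK /=; case: (enum_val a).2; rewrite /= ?expr0 ?expr1 ?opprK.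
  have sE a : bsgn (flip_label tau a) = bsgn a by rewrite /bsgn bE.
  rewrite !mxE !ffunE !(inj_eq fi).
  case: (i == v); case: (j == v); rewrite ?bE ?vE ?sE /=;
    move: (bsgn _) (vsgn _) (vsgn _) => s u u'; ring.
under eq_bigr do rewrite step.
rewrite big_split /= prodrXr -deg_incident dv expr1 mulN1r //.
Qed.

Lemma fourier_odd m (H : sgraph m) n (f : 'I_m -> 'I_n) :
  odd #|edges H| -> injective f -> fourier M H f = 0.
Proof.
move=> oH fi; rewrite fourierE //.
(* Negating [s] moves a label to another block, but doing so at every vertex preserves which
   vertices share a block. Each edge factor then changes sign exactly once. *)
pose tau (t : label) : label := ((t.1.1, ~~ t.1.2), t.2).
have tauK : involutive tau by case=> [[b s] u]; rewrite /tau /= negbK.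
pose theta (x : {ffun 'I_n -> 'I_K}) : {ffun 'I_n -> 'I_K} :=
  [ffun i => flip_label tau (x i)].
apply: (@sign_reversal_mean n _ _ theta).
  apply: can_inj (theta) _ => x; apply/ffunP => i; rewrite !ffunE.
  by rewrite flip_labelK.
move=> x.
have step a b : block_Q q (flip_label tau a) (flip_label tau b) = - block_Q q a b.
  rewrite !mxE /bsgn /vsgn /block !enum_rankK /=.
  case: (enum_val a) (enum_val b) => [[i s] u] [[i' s'] u'].
  rewrite /= !xpair_eqE (inj_eq negb_inj).
  by case: s; rewrite /= ?expr0 ?expr1; ring.
under eq_bigr do rewrite !ffunE step -mulN1r.
by rewrite big_split /= prodr_const -signr_odd oH expr1 mulN1r.
Qed.
End BlockModel.

(** * The 4-cycle *)

Section C4.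

Lemma connected_neighbor m (H : sgraph m) i :
  connected_graph H -> (1 < m)%N -> exists j, adj H i j.
Proof.
move=> [_ conn] m1; have [j ji] : exists j : 'I_m, j != i.
  by have [i0|i0] := eqVneq (i : nat) 0%N; [exists (Ordinal m1)|exists (Ordinal (ltnW m1))];
    apply/eqP => /(congr1 val) /= e; rewrite -e in i0.
have /connectP[[|j' p]] := conn i j; first by move=> _ e; rewrite e eqxx in ji.
by move=> /= /andP[ij' _] _; exists j'.
Qed.

Definition c4 (i : nat) : 'I_4 := inord i.

Lemma adj_c4 i j : (i < 4)%N -> (j < 4)%N ->
  adj C4 (c4 i) (c4 j) = ((j == i.+1 %[mod 4]) || (i == j.+1 %[mod 4]))%N.
Proof. by move=> i4 j4; rewrite /adj ffunE /= !inordK. Qed.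

Lemma big_c4 (T : Type) (idx : T) (op : Monoid.com_law idx) (g : 'I_4 -> T) :
  \big[op/idx]_(i < 4) g i =
  op (g (c4 0)) (op (g (c4 1)) (op (g (c4 2)) (g (c4 3)))).
Proof.
rewrite (eq_bigr (fun i : 'I_4 => g (c4 i))) => [|i _]; last by rewrite /c4 inord_val.
rewrite -(big_mkord xpredT (fun i => g (c4 i))).
by do 4 (rewrite big_ltn //); rewrite big_geq // Monoid.mulm1.
Qed.

Lemma big_C4 (T : Type) (idx : T) (op : Monoid.com_law idx) (F : 'I_4 -> 'I_4 -> T) :
  \big[op/idx]_(e in edges C4) F e.1 e.2 =
  op (F (c4 0) (c4 1)) (op (F (c4 0) (c4 3)) (op (F (c4 1) (c4 2)) (F (c4 2) (c4 3)))).
Proof.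
rewrite big_mkcond /=.
pose G (i j : 'I_4) := if (i < j)%N && adj C4 i j then F i j else idx.
rewrite (eq_bigr (fun e : 'I_4 * 'I_4 => G e.1 e.2)); last first.
  by move=> e _; rewrite in_edges.
rewrite -(pair_bigA _ G) /=.
rewrite !big_c4 /G !adj_c4 // !inordK //= !(Monoid.mulm1, Monoid.mul1m) //.
by rewrite !Monoid.mulmA.
Qed.

Lemma adj_C4S i : (i < 3)%N -> adj C4 (c4 i) (c4 i.+1).
Proof.
by case: i => [|[|[|i]]] // _; rewrite adj_c4.
Qed.

Lemma C4_connected : connected_graph C4.
Proof.
split => //.
have sym := @sym_connect_sym _ (adj C4) (@adj_sym _ C4).
suff h i : (i < 4)%N -> connect (adj C4) (c4 0) (c4 i).
  move=> u v; apply: (@connect_trans _ _ (c4 0)); last first.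
    by have := h v (ltn_ord v); rewrite /c4 inord_val.
  by rewrite sym; have := h u (ltn_ord u); rewrite /c4 inord_val.
elim: i => [|i IH] i4; first exact: connect0.
apply: connect_trans (IH (ltnW i4)) (connect1 _).
exact: adj_C4S.
Qed.

Lemma card_edges_C4 : #|edges C4| = 4.
Proof. by rewrite -sum1_card (big_C4 _ (fun _ _ => 1%N)). Qed.

(* [b] marks the vertices and [d] the edges of one 4-cycle that lie on another. *)
Lemma C4_shared_lt (b : 'I_4 -> bool) (d : 'I_4 * 'I_4 -> bool) :
  (forall e, d e -> b e.1 && b e.2) ->
  (0 < \sum_i b i)%N -> (\sum_(e in edges C4) d e < 4)%N ->
  (\sum_(e in edges C4) d e < \sum_i b i)%N.
Proof.
move=> db.
have -> : (\sum_(e in edges C4) d e = \sum_(e in edges C4) d (e.1, e.2))%N.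
  by apply: eq_bigr => -[].
rewrite (big_C4 _ (fun i j => nat_of_bool (d (i, j)))) !big_c4 /=.
move: (db (c4 0, c4 1)) (db (c4 0, c4 3)) (db (c4 1, c4 2)) (db (c4 2, c4 3)) => /=.
lia.
Qed.

End C4.

(** * Bounds on the coefficients of connected graphs *)

Section Connected.
Local Open Scope ring_scope.
Variable R : realType.
Variable k : nat.
Notation K := #|label k|.
Notation B := (2 * k.+1)%N.
Variables (q : R) (hq : 0 <= q <= 1).
Notation M := (block_sbm k hq).

Definition in_block n (x : {ffun 'I_n -> 'I_K}) (V : {set 'I_n}) c : R :=
  \prod_(v in V) (block (x v) == c)%:R.

Lemma in_block_mean2 n (V V' : {set 'I_n}) c c' : [disjoint V & V'] ->
  label_mean (M := M) (fun x => in_block x V c * in_block x V' c') =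
  (B%:R^-1) ^+ #|V| * (B%:R^-1) ^+ #|V'|.
Proof.
move=> dVV'.
(* Padding with the factor 1 outside the set turns the indicator into a product over all vertices,
   which splits because the labels are independent. *)
pose g (W : {set 'I_n}) d (v : 'I_n) (a : 'I_K) : R := if v \in W then (block a == d)%:R else 1.
transitivity (label_mean (M := M) (fun x => \prod_v (g V c v (x v) * g V' c' v (x v)))).
  by apply: eq_bigr => x _; rewrite big_split /= /in_block !(big_mkcond (fun v => v \in _)).
rewrite (label_mean_prod (M := M) (fun v a => g V c v a * g V' c' v a)).
rewrite -!prodr_const !(big_mkcond (fun v => v \in _)) -big_split /=.
apply: eq_bigr => v _; rewrite /g.
have [vV|vV] := boolP (v \in V); have [vV'|vV'] := boolP (v \in V').
- by move/pred0P: dVV' => /(_ v) /=; rewrite vV vV'.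
- by rewrite mulr1 -(block_freq R c); apply: eq_bigr => a _; rewrite mulr1.
- by rewrite mul1r -(block_freq R c'); apply: eq_bigr => a _; rewrite mul1r.
- by rewrite mulr1 -[RHS](block_p_sum R k); apply: eq_bigr => a _; rewrite mulr1.
Qed.

Lemma in_block_mean n (V : {set 'I_n}) c :
  label_mean (M := M) (fun x => in_block x V c) = (B%:R^-1) ^+ #|V|.
Proof.
have dV0 : [disjoint V & finset.set0] by rewrite -finset.setI_eq0 finset.setI0.
have := in_block_mean2 c c dV0.
rewrite cards0 expr0 mulr1 => <-; apply: eq_bigr => x _.
by rewrite [in_block x finset.set0 c]big_set0 mulr1.
Qed.

(** Only the block of [v0] can contain all of [V], so at most one term survives. *)
Lemma sum_in_block n (x : {ffun 'I_n -> 'I_K}) (V : {set 'I_n}) v0 : v0 \in V ->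
  \sum_c in_block x V c = [forall v in V, block (x v) == block (x v0)]%:R.
Proof.
move=> v0V; rewrite (bigD1 (block (x v0))) //= [X in _ + X]big1 => [|c cn]; last first.
  by rewrite /in_block (bigD1 v0) //= eq_sym (negbTE cn) mul0r.
rewrite addr0 /in_block; case: (boolP [forall _ in _, _]) => [/forall_inP h|].
  by rewrite big1 // => v /h ->.
by rewrite negb_forall_in => /exists_inP[v vV /negbTE ne]; rewrite (bigD1 v) //= ne mul0r.
Qed.

(** An edge between two blocks contributes the factor 0. A nonzero product therefore makes the block
    constant along every path. *)
Lemma connected_prod_neq m (H : sgraph m) n (f : {ffun 'I_m -> 'I_n}) i0
    (x : {ffun 'I_n -> 'I_K}) :
  connected_graph H ->
  ~~ [forall v in f @: 'I_m, block (x v) == block (x (f i0))] ->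
  \prod_(e in edges H) block_Q k q (x (f e.1)) (x (f e.2)) = 0.
Proof.
move=> [_ conn]; apply: contraNeq => ne0.
have adjE i j : adj H i j -> block (x (f i)) = block (x (f j)).
  have lt_case (a b : 'I_m) : (a < b)%N -> adj H a b -> block (x (f a)) = block (x (f b)).
    move=> ab aab; apply/eqP; apply: contraNT ne0 => /negbTE ne.
    have eab : (a, b) \in edges H by rewrite in_edges /= ab.
    by rewrite (bigD1 (a, b)) //= mxE ne mulr0 !mul0r.
  have [ij|ji|/ord_inj ->] := ltngtP i j; rewrite ?adj_irr //; first exact: lt_case.
  by rewrite adj_sym => /(lt_case _ _ ji).
apply/forall_inP => _ /imsetP[i _ ->]; apply/eqP.
have /connectP[p] := conn i i0.
elim: p i => [|j p IH] i /=; first by move=> _ ->.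
by move=> /andP[/adjE -> /IH h] /h.
Qed.

Lemma norm_prod_le n (E : {set 'I_n * 'I_n}) (y : 'I_n -> 'I_K) :
  `|\prod_(e in E) block_Q k q (y e.1) (y e.2)| <= q ^+ #|E|.
Proof.
rewrite normr_prod -prodr_const; apply: ler_prod => e _.
by rewrite normr_ge0 norm_block_Q_le; case/andP: hq.
Qed.

(** The product is at most [q ^+ #|edges H|] in absolute value and vanishes unless all [m] labels
    lie in one block. There are [B] choices of that block, each of probability [B] to the power
    [-m]. *)
Lemma connected_fourier_le m (H : sgraph m) n (f : {ffun 'I_m -> 'I_n}) :
  injective f -> connected_graph H ->
  `|fourier M H f| <= q ^+ #|edges H| * (B%:R^-1) ^+ m.-1.
Proof.
move=> fi cH; have [m0 _] := cH.
pose i0 := Ordinal m0.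
rewrite fourierE //; apply: (le_trans (ler_norm_label_mean _)).
apply: (@le_trans _ _ (label_mean (M := M)
    (fun x => q ^+ #|edges H| * \sum_c in_block x (f @: 'I_m) c))).
  apply: ler_label_mean => x.
  rewrite (@sum_in_block _ _ _ (f i0)) ?imset_f //.
  case: (boolP [forall _ in _, _]) => [_|/(connected_prod_neq cH) ->].
    by rewrite mulr1; exact: (@norm_prod_le m (edges H) (fun i => x (f i))).
  by rewrite mulr0 normr0.
rewrite label_meanZ label_mean_sum ler_wpM2l ?exprn_ge0 //; first by case/andP: hq.
under eq_bigr do rewrite in_block_mean.
rewrite sumr_const card_imset // card_ord card_prod card_ord card_bool.
rewrite -[m in X in X <= _](prednK m0) exprS -[_ *+ (k.+1 * 2)]mulr_natl mulrA (mulnC k.+1).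
by rewrite divff ?mul1r ?pnatr_eq0.
Qed.

Lemma fourier_le m (H : sgraph m) n (f : {ffun 'I_m -> 'I_n}) :
  injective f -> `|fourier M H f| <= q ^+ #|edges H|.
Proof.
move=> fi; rewrite fourierE //; apply: (le_trans (ler_norm_label_mean _)).
rewrite -[leRHS](label_mean_cst M n); apply: ler_label_mean => x.
exact: (@norm_prod_le m (edges H) (fun i => x (f i))).
Qed.
End Connected.

(** * Second moments of signed counts and the null variance *)

Section Moments.
Local Open Scope ring_scope.
Variable R : realType.

(** When every vertex has a neighbor, the vertex set of a copy is the set of endpoints of its
    edges. *)
Lemma copy_edges_inj m (H : sgraph m) n (S S' : {set 'I_n} * sgraph n) :
  (forall i, exists j, adj H i j) ->
  subgraph_iso H S -> subgraph_iso H S' -> edges S.2 = edges S'.2 -> S = S'.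
Proof.
move=> noiso.
have vE (T : {set 'I_n} * sgraph n) : subgraph_iso H T ->
    T.1 = [set v | [exists w, adj T.2 v w]].
  move=> /andP[/forallP sub /existsP[f /and3P[_ /eqP im /forallP hf]]].
  apply/setP => v; rewrite inE; apply/idP/existsP => [|[w vw]]; last first.
    by have /forallP/(_ w) := sub v; rewrite vw => /andP[].
  rewrite -im => /imsetP[i _ ->]; have [j ij] := noiso i.
  by exists (f j); have /forallP/(_ j)/eqP -> := hf i.
move=> /vE e /vE e' /edges_inj eE; case: S S' e e' eE => [V G] [V' G'] /= -> -> <- //.
Qed.

Section Pmf.
Variables (n : nat) (mu : sgraph n -> R).
Implicit Types f g : sgraph n -> R.

Lemma pmf_meanZ c f : pmf_mean mu (fun G => c * f G) = c * pmf_mean mu f.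
Proof. by rewrite /pmf_mean mulr_sumr; apply: eq_bigr => G _; rewrite mulrCA. Qed.

Lemma pmf_meanD f g : pmf_mean mu (fun G => f G + g G) = pmf_mean mu f + pmf_mean mu g.
Proof. by rewrite /pmf_mean -big_split; apply: eq_bigr => G _; rewrite mulrDr. Qed.

Lemma pmf_mean_sum (I : finType) (P : pred I) (F : I -> sgraph n -> R) :
  pmf_mean mu (fun G => \sum_(i | P i) F i G) = \sum_(i | P i) pmf_mean mu (F i).
Proof. by rewrite /pmf_mean exchange_big /=; apply: eq_bigr => x _; rewrite mulr_sumr. Qed.

Lemma pmf_varE f : pmf_mean mu (fun=> 1) = 1 ->
  pmf_var mu f = pmf_mean mu (fun G => f G ^+ 2) - pmf_mean mu f ^+ 2.
Proof.
move=> mass; rewrite /pmf_var; set e := pmf_mean mu f.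
transitivity (pmf_mean mu (fun G => f G ^+ 2 + ((- 2 * e) * f G + e ^+ 2 * 1))).
  by apply: eq_bigr => G _; congr (_ * _); ring.
by rewrite !pmf_meanD !pmf_meanZ mass -/e; ring.
Qed.
End Pmf.

(** The Fourier-Walsh character indexed by [E]. *)
Definition chi n (E : {set 'I_n * 'I_n}) (G : sgraph n) : R :=
  \prod_(e in E) edge_sign R G e.1 e.2.

Definition symdiff (T : finType) (A B : {set T}) : {set T} :=
  (A :\: B) :|: (B :\: A).

Lemma big_symdiff (T : finType) (A B : {set T}) (F : T -> R) :
  \prod_(e in symdiff A B) F e = (\prod_(e in A :\: B) F e) * \prod_(e in B :\: A) F e.
Proof.
rewrite (big_setID A) /=; congr (_ * _); apply: eq_bigl => e; rewrite !inE.
  by case: (e \in A); case: (e \in B).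
by case: (e \in A); case: (e \in B).
Qed.

Lemma card_symdiff (T : finType) (A B : {set T}) :
  (#|symdiff A B| + 2 * #|A :&: B| = #|A| + #|B|)%N.
Proof.
rewrite /symdiff cardsU.
have -> : (A :\: B) :&: (B :\: A) = finset.set0.
  by apply/setP => e; rewrite !inE; case: (e \in A); rewrite ?andbF.
rewrite cards0 subn0 -(cardsID B A) -(cardsID A B) (finset.setIC B A); lia.
Qed.

(** Edge signs square to 1, so the common edges cancel. *)
Lemma chi_mul n (E E' : {set 'I_n * 'I_n}) G : chi E G * chi E' G = chi (symdiff E E') G.
Proof.
rewrite /chi big_symdiff (big_setID E') [X in _ * X](big_setID E) /=.
rewrite (finset.setIC E' E) mulrACA -big_split /= [X in X * _]big1 ?mul1r // => e _.
by rewrite /edge_sign; case: (adj _ _ _) => /=; ring.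
Qed.

Lemma chi0 n (G : sgraph n) : chi finset.set0 G = 1.
Proof. by rewrite /chi big_set0. Qed.

Lemma symdiff_lt n (E E' : {set 'I_n * 'I_n}) :
  {in E, forall e : 'I_n * 'I_n, (e.1 < e.2)%N} ->
  {in E', forall e : 'I_n * 'I_n, (e.1 < e.2)%N} ->
  {in symdiff E E', forall e : 'I_n * 'I_n, (e.1 < e.2)%N}.
Proof. by move=> h h' e; rewrite !inE => /orP[] /andP[_]; [exact: h|exact: h']. Qed.

Lemma edges_lt n (G : sgraph n) : {in edges G, forall e : 'I_n * 'I_n, (e.1 < e.2)%N}.
Proof. by move=> e; rewrite in_edges => /andP[]. Qed.

Lemma mean_signed_count n (mu : sgraph n -> R) m (H : sgraph m) :
  pmf_mean mu (@signed_count R m H n) =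
  \sum_(S | subgraph_iso H S) pmf_mean mu (chi (edges S.2)).
Proof. exact: pmf_mean_sum. Qed.

Lemma mean_signed_count2 n (mu : sgraph n -> R) m (H : sgraph m) :
  pmf_mean mu (fun G => signed_count R H G ^+ 2) =
  \sum_(S | subgraph_iso H S) \sum_(S' | subgraph_iso H S')
    pmf_mean mu (chi (symdiff (edges S.2) (edges S'.2))).
Proof.
under eq_bigr do rewrite -pmf_mean_sum.
rewrite -pmf_mean_sum; apply: eq_bigr => G _; congr (_ * _).
rewrite expr2 {1}/signed_count mulr_suml; apply: eq_bigr => S _.
rewrite /signed_count mulr_sumr; apply: eq_bigr => S' _; exact: chi_mul.
Qed.

Section Null.
Variable n : nat.
Let nu := @gnp_pmf R n (1 / 2).

Lemma null_mean_chi (E : {set 'I_n * 'I_n}) :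
  {in E, forall e : 'I_n * 'I_n, (e.1 < e.2)%N} ->
  pmf_mean nu (chi E) = (E == finset.set0)%:R.
Proof.
move=> Elt; rewrite [LHS](indep_edges_mean _ Elt).
have [->|/finset.set0Pn[e eE]] := eqVneq; first by rewrite big_set0.
by rewrite (bigD1 e) //= (_ : 2 * (1 / 2) - 1 = 0) ?mul0r //; field.
Qed.

Lemma null_mass : pmf_mean nu (fun=> 1) = 1.
Proof.
have := @null_mean_chi finset.set0; rewrite eqxx => h; rewrite -[RHS]h; last first.
  by move=> e; rewrite inE.
by apply: eq_bigr => G _; rewrite chi0.
Qed.

Lemma symdiff_eq0 (T : finType) (A B : {set T}) : (symdiff A B == finset.set0) = (A == B).
Proof. by rewrite /symdiff finset.setU_eq0 !finset.setD_eq0 finset.eqEsubset. Qed.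

Variables (m : nat) (H : sgraph m).
Hypothesis H_edges : (0 < #|edges H|)%N.

Lemma null_mean_signed_count : pmf_mean nu (@signed_count R m H n) = 0.
Proof.
rewrite mean_signed_count big1 // => S /subgraph_isoP[f [fi _ fE]].
rewrite null_mean_chi; last exact: edges_lt.
rewrite fE -cards_eq0 card_in_imset; last exact: place_inj.
by rewrite gtn_eqF.
Qed.

Lemma null_varE : pmf_var nu (@signed_count R m H n) =
  \sum_(S : {set 'I_n} * sgraph n | subgraph_iso H S)
    \sum_(S' : {set 'I_n} * sgraph n | subgraph_iso H S') (edges S.2 == edges S'.2)%:R.
Proof.
rewrite pmf_varE ?null_mass // null_mean_signed_count expr0n subr0 mean_signed_count2.
apply: eq_bigr => S _; apply: eq_bigr => S' _.
by rewrite null_mean_chi ?symdiff_eq0 //; apply: symdiff_lt; exact: edges_lt.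
Qed.

Lemma sum_copies_cst :
  \sum_(S : {set 'I_n} * sgraph n | subgraph_iso H S) (1 : R) = (num_copies H n)%:R.
Proof. by rewrite sumr_const. Qed.

(** The diagonal pairs already give this much. If [H] has isolated vertices, distinct copies may
    share their edge set and add to it. *)
Lemma null_var_ge : (num_copies H n)%:R <= pmf_var nu (@signed_count R m H n).
Proof.
rewrite null_varE -sum_copies_cst; apply: ler_sum => S HS.
by rewrite (bigD1 S) //= eqxx lerDl sumr_ge0 // => S' _; rewrite ler0n.
Qed.

Lemma null_var_eq : (forall i, exists j, adj H i j) ->
  pmf_var nu (@signed_count R m H n) = (num_copies H n)%:R.
Proof.
move=> noiso; rewrite null_varE -sum_copies_cst; apply: eq_bigr => S HS.
rewrite (bigD1 S) //= eqxx [X in _ + X]big1 ?addr0 // => S' /andP[HS' ne].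
case: eqP => // e; case/eqP: ne; exact/esym/(copy_edges_inj noiso).
Qed.
End Null.
End Moments.

(** * Mean and variance of the signed 4-cycle count in the block model *)

Section Planted.
Local Open Scope ring_scope.
Variable R : realType.
Variable k : nat.
Notation K := #|label k|.
Notation B := (2 * k.+1)%N.
Variables (q : R) (hq : 0 <= q <= 1).
Notation M := (block_sbm k hq).
Variable n : nat.
Let mu := @sbm_pmf R M n.

Lemma sbm_mean_chi m (H : sgraph m) S f : embeds H S f ->
  pmf_mean mu (chi R (edges S.2)) = fourier M H f.
Proof.
move=> [fi _ fE]; apply: eq_bigr => G _; congr (_ * _).
by rewrite /chi fE (big_place _ fi) //; exact: edge_sign_sym.
Qed.

Lemma sbm_mass : pmf_mean mu (fun=> 1) = 1.
Proof.
have set0_lt : {in (finset.set0 : {set 'I_n * 'I_n}), forall e : 'I_n * 'I_n, (e.1 < e.2)%N}.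
  by move=> e; rewrite inE.
transitivity (pmf_mean mu (chi R finset.set0)).
  by apply: eq_bigr => G _; rewrite chi0.
rewrite [LHS](sbm_mean M set0_lt) -[RHS](label_mean1 M n).
by apply: eq_bigr => x _; rewrite big_set0.
Qed.

Lemma planted_mean_le m (H : sgraph m) c :
  (forall f : {ffun 'I_m -> 'I_n}, injective f -> `|fourier M H f| <= c) ->
  `|pmf_mean mu (@signed_count R m H n)| <= (num_copies H n)%:R * c.
Proof.
move=> hc; rewrite mean_signed_count; apply: (le_trans (ler_norm_sum _ _ _)).
rewrite -sum_copies_cst mulr_suml; apply: ler_sum => S /subgraph_isoP[f Sf].
by rewrite mul1r (sbm_mean_chi Sf) hc //; case: Sf.
Qed.

(** Inside one block the common sign [s] occurs four times and the sign [u] of each vertex twice, so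
    all signs cancel. This is why the bound for connected graphs is attained here. *)
Lemma C4_prod (f : {ffun 'I_4 -> 'I_n}) (x : {ffun 'I_n -> 'I_K}) :
  \prod_(e in edges C4) block_Q k q (x (f e.1)) (x (f e.2)) =
  q ^+ 4 * \sum_c in_block R x (f @: 'I_4) c.
Proof.
rewrite (@sum_in_block _ _ _ _ _ (f (c4 0))) ?imset_f //.
case: (boolP [forall _ in _, _]) => [/forall_inP eq0|]; last first.
  move=> /(connected_prod_neq q C4_connected) ->.
  by rewrite mulr0.
rewrite mulr1 (@big_C4 _ _ _ (fun i j => block_Q k q (x (f i)) (x (f j)))).
have bE i : block (x (f i)) = block (x (f (c4 0))) by apply/eqP/eq0; rewrite imset_f.
rewrite !mxE /bsgn !bE !eqxx !mulr1.
have sq (b : bool) : ((-1) ^+ b * (-1) ^+ b : R) = 1 by rewrite -expr2 sqrr_sign.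
have cyc (s a b c d : R) : s * s = 1 -> a * a = 1 -> b * b = 1 -> c * c = 1 -> d * d = 1 ->
    (q * s * (a * b)) * ((q * s * (a * d)) * ((q * s * (b * c)) * (q * s * (c * d)))) = q ^+ 4.
  move=> ss aa bb cc dd.
  transitivity (q ^+ 4 * (s * s) * (s * s) * (a * a) * (b * b) * (c * c) * (d * d)); first by ring.
  by rewrite ss aa bb cc dd !mulr1.
by apply: cyc; rewrite /vsgn ?sq.
Qed.

Definition C4_coeff : R := q ^+ 4 * B%:R^-1 ^+ 3.

Lemma sum_block_cst (c : R) : \sum_(d : 'I_k.+1 * bool) c = B%:R * c.
Proof. by rewrite sumr_const card_prod card_ord card_bool mulnC mulr_natl. Qed.

Lemma B_neq0 : (B%:R : R) != 0.
Proof. by rewrite pnatr_eq0. Qed.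

Lemma C4_fourier (f : {ffun 'I_4 -> 'I_n}) : injective f -> fourier M C4 f = C4_coeff.
Proof.
move=> fi; rewrite fourierE //.
transitivity (label_mean (M := M) (fun x => q ^+ 4 * \sum_c in_block R x (f @: 'I_4) c)).
  by apply: eq_bigr => x _; rewrite C4_prod.
rewrite label_meanZ label_mean_sum; under eq_bigr do rewrite in_block_mean.
rewrite sum_block_cst card_imset // card_ord /C4_coeff; congr (_ * _).
by rewrite exprS mulrA divff ?mul1r // B_neq0.
Qed.

Lemma planted_mean_C4 :
  pmf_mean mu (@signed_count R 4 C4 n) = (num_copies C4 n)%:R * C4_coeff.
Proof.
rewrite mean_signed_count -sum_copies_cst mulr_suml; apply: eq_bigr => S /subgraph_isoP[f Sf].
by rewrite mul1r (sbm_mean_chi Sf) C4_fourier //; case: Sf.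
Qed.

Lemma sbm_mean_symdiff (S S' : {set 'I_n} * sgraph n) :
  pmf_mean mu (chi R (symdiff (edges S.2) (edges S'.2))) =
  label_mean (M := M) (fun x =>
    \prod_(e in symdiff (edges S.2) (edges S'.2)) block_Q k q (x e.1) (x e.2)).
Proof. by rewrite [LHS](sbm_mean M) //; apply: symdiff_lt; exact: edges_lt. Qed.

Lemma copy_prod (S : {set 'I_n} * sgraph n) (x : {ffun 'I_n -> 'I_K}) : subgraph_iso C4 S ->
  \prod_(e in edges S.2) block_Q k q (x e.1) (x e.2) = q ^+ 4 * \sum_c in_block R x S.1 c.
Proof.
move=> /subgraph_isoP[f [fi -> ->]]; rewrite -C4_prod.
rewrite (@big_place _ _ _ C4 f (fun i j => block_Q k q (x i) (x j)) fi) // => i j.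
exact: (@sbm_Q_symE R M).
Qed.

Lemma copy_endpoints m (H : sgraph m) (S : {set 'I_n} * sgraph n) e :
  subgraph_iso H S -> e \in edges S.2 -> e.1 \in S.1 /\ e.2 \in S.1.
Proof.
move=> /andP[/forallP sub _]; rewrite in_edges => /andP[_ aT].
by have /forallP/(_ e.2) := sub e.1; rewrite aT => /andP[].
Qed.

(** The two copies depend on disjoint families of independent labels, so the mean of the product is
    the product of the means and the covariance is zero. *)
Lemma planted_disjoint_pair (S S' : {set 'I_n} * sgraph n) :
  subgraph_iso C4 S -> subgraph_iso C4 S' -> [disjoint S.1 & S'.1] ->
  pmf_mean mu (chi R (symdiff (edges S.2) (edges S'.2))) = C4_coeff ^+ 2.
Proof.
move=> HS HS' dS; rewrite sbm_mean_symdiff.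
have card4 T : subgraph_iso C4 T -> #|T.1| = 4 :> nat.
  by move=> /subgraph_isoP[f [fi -> _]]; rewrite card_imset // card_ord.
have dE : edges S.2 :&: edges S'.2 = finset.set0.
  apply/setP => e; rewrite finset.inE finset.in_set0; apply/negbTE/negP => /andP[eS eS'].
  have [e1 _] := copy_endpoints HS eS; have [e1' _] := copy_endpoints HS' eS'.
  by have := disjointFr dS e1; rewrite e1'.
have dE1 : edges S.2 :\: edges S'.2 = edges S.2.
  by rewrite -{2}(finset.setID (edges S.2) (edges S'.2)) dE finset.set0U.
have dE2 : edges S'.2 :\: edges S.2 = edges S'.2.
  by rewrite -{2}(finset.setID (edges S'.2) (edges S.2)) finset.setIC dE finset.set0U.
transitivity (label_mean (M := M) (fun x =>
    q ^+ 8 * \sum_c \sum_c' (in_block R x S.1 c * in_block R x S'.1 c'))).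
  apply: eq_bigr => x _; congr (_ * _).
  have -> : \sum_c \sum_c' in_block R x S.1 c * in_block R x S'.1 c' =
     (\sum_c in_block R x S.1 c) * (\sum_c in_block R x S'.1 c).
    by rewrite mulr_suml; apply: eq_bigr => c _; rewrite mulr_sumr.
  by rewrite (exprD q 4 4) mulrACA -!copy_prod // big_symdiff dE1 dE2.
rewrite label_meanZ label_mean_sum.
under eq_bigr do rewrite label_mean_sum.
under eq_bigr do under eq_bigr do rewrite in_block_mean2 //.
under eq_bigr do rewrite sum_block_cst.
rewrite sum_block_cst !card4 // /C4_coeff; have := B_neq0.
move: (B%:R : R) => b b0; rewrite (exprS b^-1 3).
have -> : b * (b * (b^-1 * b^-1 ^+ 3 * (b^-1 * b^-1 ^+ 3))) =
    (b / b) * (b / b) * (b^-1 ^+ 3 * b^-1 ^+ 3) by ring.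
by rewrite divff // !mul1r; move: (b^-1) => w; ring.
Qed.

Lemma planted_pair_le (S S' : {set 'I_n} * sgraph n) :
  pmf_mean mu (chi R (symdiff (edges S.2) (edges S'.2))) <=
  q ^+ #|symdiff (edges S.2) (edges S'.2)|.
Proof.
rewrite sbm_mean_symdiff; apply: (le_trans (ler_norm _)).
apply: (le_trans (ler_norm_label_mean _)).
rewrite -[leRHS](label_mean_cst M n); apply: ler_label_mean => x.
exact: norm_prod_le.
Qed.

(** With [r] shared vertices and [s] shared edges the symmetric difference has [8 - 2s] edges, and
    [s < r] gives [8 - 2s >= 10 - 2r]. Spreading [q] to the power [-2r] over the vertices prepares a
    sum over [f] that factors. *)
Lemma planted_meeting_pair (S S' : {set 'I_n} * sgraph n) (f : {ffun 'I_4 -> 'I_n}) :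
  0 < q -> subgraph_iso C4 S -> embeds C4 S' f ->
  S' != S -> ~~ [disjoint S.1 & S'.1] ->
  pmf_mean mu (chi R (symdiff (edges S.2) (edges S'.2))) <=
  q ^+ 10 * \prod_i (if f i \in S.1 then q ^- 2 else 1).
Proof.
move=> q0 HS S'f SS' ndS; apply: (le_trans (planted_pair_le _ _)).
have HS' : subgraph_iso C4 S' by apply/subgraph_isoP; exists f.
have card4 T : subgraph_iso C4 T -> #|edges T.2| = 4.
  move=> /subgraph_isoP[g [gi _ ->]]; rewrite card_in_imset ?card_edges_C4 //.
  exact: place_inj.
have [fi fV fE] := S'f.
set r := (\sum_i (f i \in S.1))%N.
set s := (\sum_(e in edges C4) (place f e \in edges S.2))%N.
have -> : \prod_i (if f i \in S.1 then q ^- 2 else 1) = q ^- 2 ^+ r.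
  rewrite /r -prodrXr; apply: eq_bigr => i _.
  by case: (_ \in _); rewrite ?expr1 ?expr0.
have sE : #|edges S.2 :&: edges S'.2| = s.
  transitivity (\sum_(e in place f @: edges C4) (e \in edges S.2))%N.
    rewrite -sum1_card fE big_mkcond [RHS]big_mkcond; apply: eq_bigr => e _.
    by rewrite finset.inE; case: (e \in edges _); case: (e \in _ @: _).
  by rewrite big_imset //; exact: place_inj.
have sr : (s < r)%N.
  apply: C4_shared_lt.
  - move=> [i j] /(copy_endpoints HS) /=; rewrite /place /=.
    by case: ifP => _ /= [-> ->].
  - rewrite lt0n; apply: contraNneq ndS => /eqP; rewrite sum_nat_eq0 => /forallP r0.
    rewrite disjoint_sym fV; apply/pred0P => v /=; apply/negbTE/negP => /andP[/imsetP[i _ ->]].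
    by have := r0 i; rewrite implyTb eqb0 => /negP.
  (* Sharing all four edges would make the edge sets equal, hence the copies too. *)
  - rewrite -/s ltnNge; apply: contra SS' => s4; apply/eqP.
    apply: (@copy_edges_inj _ C4 _ _ _ _ HS' HS).
      by move=> i; exact: connected_neighbor C4_connected _.
    have e1 : edges S.2 :&: edges S'.2 = edges S.2.
      by apply/eqP; rewrite finset.eqEcard finset.subsetIl sE card4.
    have e2 : edges S.2 :&: edges S'.2 = edges S'.2.
      by apply/eqP; rewrite finset.eqEcard finset.subsetIr sE card4.
    by rewrite -e2 e1.
have := card_symdiff (edges S.2) (edges S'.2); rewrite sE !card4 // => cE.
case/andP: hq => _ q1.
rewrite exprVn -exprM ler_pdivlMr ?exprn_gt0 // -exprD ler_wiXn2l ?(ltW q0) //.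
lia.
Qed.

(** For a fixed copy [S], the pair with itself contributes at most 1. The other pairs are bounded by
    a sum over all maps, which is the fourth power of a sum over vertices: the four in [S] weigh
    [q ^- 2] each, and the at most [n] others weigh 1. *)
Lemma planted_var_C4 : 0 < q ->
  pmf_var mu (@signed_count R 4 C4 n) <=
  (num_copies C4 n)%:R * (1 + q ^+ 10 * (4 * q ^- 2 + n%:R) ^+ 4).
Proof.
move=> q0; rewrite pmf_varE ?sbm_mass // planted_mean_C4 mean_signed_count2.
rewrite -sum_copies_cst.
have -> : ((\sum_(S : {set 'I_n} * sgraph n | subgraph_iso C4 S) 1) * C4_coeff) ^+ 2 =
    \sum_(S : {set 'I_n} * sgraph n | subgraph_iso C4 S)
    \sum_(S' : {set 'I_n} * sgraph n | subgraph_iso C4 S') C4_coeff ^+ 2.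
  rewrite mulr_suml expr2 mulr_suml; apply: eq_bigr => S _; rewrite mulr_sumr.
  by apply: eq_bigr => S' _; rewrite !mul1r expr2.
rewrite -sumrB mulr_suml; apply: ler_sum => S HS; rewrite mul1r -sumrB.
rewrite (bigD1 S) //=; apply: lerD.
  rewrite lerBlDr; apply: (le_trans (planted_pair_le _ _)).
  rewrite (_ : symdiff _ _ = finset.set0) ?cards0 ?expr0 ?lerDl ?sqr_ge0 //.
  by apply/eqP; rewrite symdiff_eq0.
have winv : 0 <= q ^- 2 by rewrite invr_ge0 exprn_ge0 // ltW.
have w0 (b : bool) : 0 <= (if b then q ^- 2 else 1) by case: b.
pose g (f : {ffun 'I_4 -> 'I_n}) := q ^+ 10 * \prod_i (if f i \in S.1 then q ^- 2 else 1).
have g0 f : 0 <= g f.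
  by rewrite mulr_ge0 ?exprn_ge0 ?(ltW q0) // prodr_ge0.
apply: (@le_trans _ _ (\sum_f g f)).
  apply: sum_copies_le => // S' f SS' S'f.
  have HS' : subgraph_iso C4 S' by apply/subgraph_isoP; exists f.
  have [dS|ndS] := boolP [disjoint S.1 & S'.1].
    by rewrite planted_disjoint_pair // subrr.
  rewrite lerBlDr; apply: (le_trans (planted_meeting_pair q0 HS S'f SS' ndS)).
  by rewrite lerDl sqr_ge0.
rewrite -mulr_sumr ler_wpM2l ?exprn_ge0 ?(ltW q0) //.
rewrite -(bigA_distr_bigA (fun _ v => if v \in S.1 then q ^- 2 else 1)) /=.
rewrite prodr_const card_ord lerXn2r ?nnegrE ?addr_ge0 ?mulr_ge0 ?sumr_ge0 //.
rewrite (bigID (mem S.1)) /=; apply: lerD.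
  rewrite (eq_bigr (fun=> q ^- 2)) => [|v ->] //.
  rewrite sumr_const; case/subgraph_isoP: HS => f [fi -> _].
  by rewrite card_imset // card_ord mulr_natl.
rewrite (eq_bigr (fun=> 1)) => [|v /negbTE ->] //.
by rewrite sumr_const ler_nat -[leqRHS]card_ord max_card.
Qed.
End Planted.

(** * Connected graphs without leaves *)

Section NoLeaf.

Lemma edges_gt1 m (H : sgraph m) : (0 < #|edges H|)%N -> (1 < m)%N.
Proof.
case/card_gt0P => -[i j]; rewrite in_edges /= => /andP[ij _].
by have := ltn_ord j; lia.
Qed.

Lemma deg_ge2 m (H : sgraph m) :
  connected_graph H -> (0 < #|edges H|)%N -> ~ has_leaf H ->
  forall v, (1 < deg H v)%N.
Proof.
move=> cH eH nl v; have [w vw] := connected_neighbor v cH (edges_gt1 eH).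
rewrite ltn_neqAle; apply/andP; split.
  by apply/eqP => e; apply: nl; exists v.
by rewrite /deg card_gt0; apply/finset.set0Pn; exists w; rewrite inE.
Qed.

Lemma edges_ge m (H : sgraph m) : (forall v, 1 < deg H v)%N -> (m <= #|edges H|)%N.
Proof.
move=> d2; rewrite -(leq_pmul2l (isT : 0 < 2)%N) -deg_sum.
rewrite -[X in (_ * X)%N]card_ord -sum1_card big_distrr /=.
by apply: leq_sum => v _; exact: d2.
Qed.

(** The degrees sum to [2 * m] and each is at least 2, which leaves no slack. *)
Lemma deg_eq2 m (H : sgraph m) : (forall v, 1 < deg H v)%N -> #|edges H| = m ->
  forall v, deg H v = 2%N.
Proof.
move=> d2 e v; have := deg_sum H; rewrite e (bigD1 v) //= => sum_eq.
have : (2 * m.-1 <= \sum_(i | i != v) deg H i)%N.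
  have -> : m.-1 = #|[pred i | i != v]|.
    by have := cardC (pred1 v); rewrite card1 card_ord; move: #|_| => a <-.
  by rewrite -sum1_card big_distrr /=; apply: leq_sum => i _; exact: d2.
move: (\sum_(i | i != v) deg H i)%N (deg H v) (d2 v) (ltn_ord v) sum_eq => S d.
lia.
Qed.

Lemma deg_lt m (H : sgraph m) v : (deg H v < m)%N.
Proof.
rewrite -[X in (_ < X)%N]card_ord /deg; apply: proper_card.
apply/properP; split; first by apply/fintype.subsetP.
by exists v => //; rewrite inE adj_irr.
Qed.

Lemma deg4 (H : sgraph 4) v :
  deg H v = (adj H v (c4 0) + (adj H v (c4 1) + (adj H v (c4 2) + adj H v (c4 3))))%N.
Proof. by rewrite /deg -sum1dep_card big_mkcond big_c4. Qed.

Lemma iso_C4_of (H : sgraph 4) (s : nat -> nat) :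
  (forall i, i < 4 -> s i < 4)%N ->
  (forall i j, i < 4 -> j < 4 -> s i = s j -> i = j)%N ->
  (forall i j, i < j -> j < 4 ->
    adj C4 (c4 (s i)) (c4 (s j)) = adj H (c4 i) (c4 j))%N -> isomorphic H C4.
Proof.
move=> s4 si hs; pose f (i : 'I_4) : 'I_4 := c4 (s i).
exists f.
  apply: injF_bij => i j /(congr1 val); rewrite /= !inordK ?s4 // => /si e.
  by apply: ord_inj; apply: e.
move=> i j; have lt_case (a b : 'I_4) : (a < b)%N -> adj C4 (f a) (f b) = adj H a b.
  by move=> ab; rewrite hs // /c4 !inord_val.
have [ij|ji|/ord_inj ->] := ltngtP i j; last by rewrite !adj_irr.
  exact: lt_case.
by rewrite adj_sym [RHS]adj_sym lt_case.
Qed.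

(** Vertex 0 has exactly one non-neighbor, and that choice determines the graph. Each of the three
    lists sends the non-neighbor to 2, the vertex opposite 0. *)
Lemma two_regular_iso_C4 (H : sgraph 4) : (forall v, deg H v = 2%N) -> isomorphic H C4.
Proof.
move=> d2; have := d2 (c4 0); have := d2 (c4 1); have := d2 (c4 2); have := d2 (c4 3).
rewrite !deg4 !adj_irr (adj_sym H (c4 1) (c4 0)) (adj_sym H (c4 2) (c4 0))
  (adj_sym H (c4 3) (c4 0)) (adj_sym H (c4 2) (c4 1)) (adj_sym H (c4 3) (c4 1))
  (adj_sym H (c4 3) (c4 2)).
case e01: (adj H (c4 0) (c4 1)); case e02: (adj H (c4 0) (c4 2));
case e03: (adj H (c4 0) (c4 3)); case e12: (adj H (c4 1) (c4 2));
case e13: (adj H (c4 1) (c4 3)); case e23: (adj H (c4 2) (c4 3)) => //= _ _ _ _.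
- apply: (@iso_C4_of _ (nth 0%N [:: 0; 1; 3; 2])%N).
  + by case=> [|[|[|[|i]]]].
  + by case=> [|[|[|[|i]]]] // [|[|[|[|j]]]].
  + by case=> [|[|[|[|i]]]] // [|[|[|[|j]]]] // _ _;
    rewrite adj_c4 //= ?e01 ?e02 ?e03 ?e12 ?e13 ?e23.
- apply: (@iso_C4_of _ (nth 0%N [:: 0; 1; 2; 3])%N).
  + by case=> [|[|[|[|i]]]].
  + by case=> [|[|[|[|i]]]] // [|[|[|[|j]]]].
  + by case=> [|[|[|[|i]]]] // [|[|[|[|j]]]] // _ _;
    rewrite adj_c4 //= ?e01 ?e02 ?e03 ?e12 ?e13 ?e23.
- apply: (@iso_C4_of _ (nth 0%N [:: 0; 2; 1; 3])%N).
  + by case=> [|[|[|[|i]]]].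
  + by case=> [|[|[|[|i]]]] // [|[|[|[|j]]]].
  + by case=> [|[|[|[|i]]]] // [|[|[|[|j]]]] // _ _;
    rewrite adj_c4 //= ?e01 ?e02 ?e03 ?e12 ?e13 ?e23.
Qed.
End NoLeaf.

(** * A slowly growing sequence *)

Section Growth.

(* Essentially the largest [i] with [i ^ i <= n]: it tends to infinity, but more
   slowly than every positive power of [n]. *)
Definition slow n := maxn 1 (\max_(i < n.+1 | (i ^ i <= n)%N) i).

Lemma slow_gt0 n : (0 < slow n)%N.
Proof. by rewrite /slow leq_max. Qed.

Lemma slow_pow n : (0 < n)%N -> (slow n ^ slow n <= n)%N.
Proof.
move=> n0; rewrite /slow; case: (leqP 1 (\max_(i < n.+1 | (i ^ i <= n)%N) i)) => _ //.
by apply: (big_ind (fun m => m ^ m <= n)%N) => // a b; rewrite /maxn; case: ifP.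
Qed.

Lemma slow_ge J n : (J ^ J <= n)%N -> (J <= slow n)%N.
Proof.
move=> Jn; case: J Jn => // J Jn; rewrite /slow leq_max; apply/orP; right.
(* The range of the maximum loses no candidate, because a positive number is at most its own
   self-power. *)
have J1 : (J.+1 < n.+1)%N.
  by rewrite ltnS; apply: leq_trans Jn; rewrite expnS leq_pmulr // expn_gt0.
exact: (@leq_bigmax_cond _ (fun i : 'I_n.+1 => i ^ i <= n)%N (fun i => i) (Ordinal J1)).
Qed.

Local Open Scope classical_set_scope.

Lemma slow_ge_near J : \forall n \near \oo, (J <= slow n)%N.
Proof. by exists (J ^ J)%N => // n /= Jn; exact: slow_ge. Qed.

(** Once [slow n] is at least [A] and [d.+1], the left side is at most [slow n ^ d.+1], hence at
    most [slow n ^ slow n]. *)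
Lemma slow_pow_near A d : \forall n \near \oo, (A * slow n ^ d <= n)%N.
Proof.
near=> n; have n0 : (0 < n)%N by near: n; exact: nbhs_infty_gt.
apply: leq_trans (slow_pow n0).
have Aj : (A <= slow n)%N by near: n; exact: slow_ge_near.
have dj : (d.+1 <= slow n)%N by near: n; exact: slow_ge_near.
apply: (@leq_trans (slow n ^ d.+1)); first by rewrite expnS leq_mul2r Aj orbT.
by apply: leq_pexp2l; rewrite ?slow_gt0.
Unshelve. all: by end_near. Qed.

Local Open Scope ring_scope.
Lemma slow_inv_near (R : realType) (e : R) : 0 < e -> \forall n \near \oo, (slow n)%:R^-1 <= e.
Proof.
move=> e0; near=> n; rewrite invf_ple ?posrE ?ltr0n ?slow_gt0 //.
have : (Num.truncn (e^-1)).+1%:R <= (slow n)%:R :> R.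
  by rewrite ler_nat; near: n; exact: slow_ge_near.
apply: le_trans; apply/ltW; exact: truncnS_gt.
Unshelve. all: by end_near. Qed.
End Growth.

(** * Choice of parameters and comparison of gap with standard deviation *)

Section Main.
Local Open Scope ring_scope.
Local Open Scope classical_set_scope.
Variable R : realType.

(** The cap at 1 keeps the bias admissible for small [n]; it is inactive for all large [n]. *)
Definition bias n : R := Num.min 1 ((slow n)%:R ^+ 4 / Num.sqrt n%:R).

Lemma bias_itv n : 0 <= bias n <= 1.
Proof.
by rewrite /bias ge_min lexx le_min ler01 divr_ge0 ?exprn_ge0 ?ler0n ?sqrtr_ge0.
Qed.

Lemma bias_le n : bias n <= (slow n)%:R ^+ 4 / Num.sqrt n%:R.
Proof. by rewrite /bias ge_min lexx orbT. Qed.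

(** The predecessor offsets the [k.+1] in [label], so that there are exactly [2 * slow n ^ 5]
    blocks. *)
Definition model n : sbm R := block_sbm (slow n ^ 5).-1 (bias_itv n).

Lemma blocksE n : (2 * ((slow n ^ 5).-1.+1))%N = (2 * slow n ^ 5)%N.
Proof. by rewrite prednK // expn_gt0 slow_gt0. Qed.

Let gap m (H : sgraph m) : nat -> R^o := mean_gap (fun n => @sbm_pmf R (model n) n) H.
Let std m (H : sgraph m) : nat -> R^o := max_std (fun n => @sbm_pmf R (model n) n) H.

Lemma gapE m (H : sgraph m) n : (0 < #|edges H|)%N ->
  gap H n = pmf_mean (@sbm_pmf R (model n) n) (@signed_count R m H n).
Proof. by move=> eH; rewrite /gap /mean_gap null_mean_signed_count ?subr0. Qed.

Lemma sqrt_num_copies_le m (H : sgraph m) n :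
  Num.sqrt ((num_copies H n)%:R : R) <= Num.sqrt n%:R ^+ m.
Proof.
rewrite -[leRHS]ger0_norm ?exprn_ge0 ?sqrtr_ge0 // -sqrtr_sqr; apply: ler_wsqrtr.
by rewrite -exprM mulnC exprM sqr_sqrtr ?ler0n // -natrX ler_nat num_copies_le.
Qed.

(** With [N] copies the gap is at most [N * c n] and the null standard deviation at least the square
    root of [N], so their ratio is at most [Num.sqrt n%:R ^+ m * c n]. The sequence [1 / slow n]
    serves as a common rate tending to zero. *)
Lemma fails_of_fourier_le m (H : sgraph m) (c : nat -> R) :
  (0 < #|edges H|)%N ->
  (forall n (f : {ffun 'I_m -> 'I_n}), injective f -> `|fourier (model n) H f| <= c n) ->
  (forall n, 0 <= c n) ->
  (\forall n \near \oo, Num.sqrt n%:R ^+ m * c n <= (slow n)%:R^-1) ->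
  fails_to_distinguish (fun n => @sbm_pmf R (model n) n) H.
Proof.
move=> eH hc c0 small; apply/eqoP => e e0.
near=> n.
have small_n : Num.sqrt n%:R ^+ m * c n <= (slow n)%:R^-1 by near: n.
have slow_n : (slow n)%:R^-1 <= e by near: n; exact: slow_inv_near.
set N : R := (num_copies H n)%:R.
have N0 : 0 <= N by rewrite ler0n.
have gap_le : `|gap H n| <= N * c n.
  by rewrite gapE //; apply: planted_mean_le => f; exact: hc.
have std_ge : Num.sqrt N <= `|std H n|.
  apply: le_trans (ler_norm _); rewrite /std /max_std le_max; apply/orP; left.
  by apply: ler_wsqrtr; exact: null_var_ge.
change (`|gap H n| <= e * `|std H n|).
apply: (le_trans gap_le).
apply: (@le_trans _ _ (e * Num.sqrt N)); last by rewrite ler_wpM2l // ltW.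
rewrite -{1}(sqr_sqrtr N0) expr2 -mulrA mulrC ler_wpM2r ?sqrtr_ge0 //.
apply: le_trans slow_n; apply: le_trans small_n.
by rewrite ler_wpM2r // sqrt_num_copies_le.
Unshelve. all: by end_near. Qed.

Lemma sqrt_bias_le n m : Num.sqrt n%:R ^+ m * bias n ^+ m <= (slow n)%:R ^+ (4 * m).
Proof.
rewrite -exprMn exprM; have /andP[b0 _] := bias_itv n.
have [n0|n0] := posnP n.
  rewrite n0 sqrtr0 mul0r; apply: lerXn2r; rewrite ?nnegrE ?exprn_ge0 //.
have s0 : 0 < Num.sqrt n%:R :> R by rewrite sqrtr_gt0 ltr0n.
apply: lerXn2r; rewrite ?nnegrE ?exprn_ge0 ?mulr_ge0 ?ler0n ?(ltW s0) //.
by rewrite mulrC -ler_pdivlMr // bias_le.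
Qed.

Lemma fails_excess_edges m (H : sgraph m) :
  (m < #|edges H|)%N -> fails_to_distinguish (fun n => @sbm_pmf R (model n) n) H.
Proof.
move=> mE; have E0 : (0 < #|edges H|)%N by apply: leq_ltn_trans mE.
apply: (@fails_of_fourier_le _ _ (fun n => bias n ^+ #|edges H|)) => //.
- by move=> n f fi; exact: fourier_le.
- by move=> n; rewrite exprn_ge0 //; case/andP: (bias_itv n).
pose E := #|edges H|; near=> n.
have n0 : (0 < n)%N by near: n; exact: nbhs_infty_gt.
(* The exponent makes the square root of [n] at least [j ^ (4 * E).+1]. Since [m < E], one such root
   is left over to absorb [j ^ (4 * E)] and leave [1 / j]. *)
have jn : (1 * slow n ^ ((4 * E).+1 * 2) <= n)%N by near: n; exact: slow_pow_near.
set j := slow n in jn *; rewrite -/E.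
have s0 : 0 < Num.sqrt n%:R :> R by rewrite sqrtr_gt0 ltr0n.
have s1 : 1 <= Num.sqrt n%:R :> R by rewrite -[leLHS]sqrtr1 ler_wsqrtr // ler1n.
have js : (j%:R : R) ^+ (4 * E).+1 <= Num.sqrt n%:R.
  rewrite -[leLHS]ger0_norm ?exprn_ge0 // -sqrtr_sqr ler_wsqrtr // -exprM -natrX ler_nat.
  by rewrite mul1n in jn.
have j0 : 0 < j%:R :> R by rewrite ltr0n slow_gt0.
have b0 : 0 <= bias n by case/andP: (bias_itv n).
apply: (@le_trans _ _ ((j%:R : R) ^+ (4 * E) / Num.sqrt n%:R)).
  rewrite ler_pdivlMr //; apply: le_trans (sqrt_bias_le n E).
  rewrite mulrAC -exprSr ler_wpM2r ?exprn_ge0 //.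
  by rewrite ler_weXn2l.
by rewrite ler_pdivrMr // ler_pdivlMl // -exprS.
Unshelve. all: by end_near. Qed.

Lemma fails_unicyclic m (H : sgraph m) :
  connected_graph H -> #|edges H| = m -> (6 <= m)%N ->
  fails_to_distinguish (fun n => @sbm_pmf R (model n) n) H.
Proof.
move=> cH Em m6; have E0 : (0 < #|edges H|)%N by rewrite Em; lia.
apply: (@fails_of_fourier_le _ _ (fun n =>
    bias n ^+ m * ((2 * ((slow n ^ 5).-1.+1))%:R^-1) ^+ m.-1)) => //.
- by move=> n f fi; have := connected_fourier_le (slow n ^ 5).-1 (bias_itv n) fi cH; rewrite Em.
- by move=> n; rewrite mulr_ge0 ?exprn_ge0 ?invr_ge0 //; case/andP: (bias_itv n).
near=> n; rewrite blocksE; set j := slow n.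
have j0 : 0 < j%:R :> R by rewrite ltr0n slow_gt0.
have j1 : 1 <= j%:R :> R by rewrite ler1n slow_gt0.
rewrite mulrA; apply: (@le_trans _ _ ((j%:R : R) ^+ (4 * m) * (j%:R ^- 5) ^+ m.-1)).
  apply: ler_pM; rewrite ?mulr_ge0 ?exprn_ge0 ?invr_ge0 ?sqrt_bias_le //.
  - by case/andP: (bias_itv n).
  - apply: lerXn2r; rewrite ?nnegrE ?invr_ge0 ?exprn_ge0 //.
    rewrite lef_pV2 ?posrE ?exprn_gt0 ?ltr0n ?muln_gt0 ?expn_gt0 ?slow_gt0 //.
    by rewrite -natrX ler_nat leq_pmull.
rewrite exprVn -exprM ler_pdivrMr ?exprn_gt0 // ler_pdivlMl // -exprS.
(* The exponents require [4 * m + 1 <= 5 * (m - 1)], which is the condition [6 <= m]. *)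
apply: ler_weXn2l => //; lia.
Unshelve. all: by end_near. Qed.

Lemma C4_distinguishes : distinguishes (fun n => @sbm_pmf R (model n) n) C4.
Proof.
move=> C C0.
(* The gap will be at least [n ^ 2 * j / 8 ^ 5] and the deviation at most [2 * n ^ 2]. Hence
   [j >= 2 * 8 ^ 5 * C] nearly suffices, and doubling it gives strictness. *)
have c0 : 0 < 4 * 8 ^+ 5 * C.
  by apply: mulr_gt0 => //; apply: mulr_gt0 => //; exact: exprn_gt0.
near=> n.
have jC : (slow n)%:R^-1 <= (4 * 8 ^+ 5 * C)^-1.
  near: n; apply: slow_inv_near; rewrite invr_gt0; exact: c0.
have n4 : (3 < n)%N by near: n; exact: nbhs_infty_gt.
(* Rounding down [n / 4] loses at most a factor 2 once [n] is at least 4; this feeds the lower bound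
   on the number of copies. *)
have n8 : (n <= n %/ 4 * 8)%N by lia.
(* This puts [j ^ 4] below the square root of [n], so the cap in [bias] is inactive. In the next
   line, 625 is [5 ^ 4] and [j ^ 40] comes from [bias n ^+ 10]. *)
have jn8 : (1 * slow n ^ 8 <= n)%N by near: n; exact: slow_pow_near.
have jn40 : (625 * slow n ^ 40 <= n)%N by near: n; exact: slow_pow_near.
set j := slow n in jn8 jn40 jC *; set N : R := (num_copies C4 n)%:R.
have j0 : 0 < j%:R :> R by rewrite ltr0n slow_gt0.
have j1 : 1 <= j%:R :> R by rewrite ler1n slow_gt0.
have n0 : 0 < n%:R :> R by rewrite ltr0n; exact: leq_ltn_trans n4.
have s0 : 0 < Num.sqrt n%:R :> R by rewrite sqrtr_gt0.
have biasE : bias n = j%:R ^+ 4 / Num.sqrt n%:R.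
  rewrite /bias min_r // ler_pdivrMr // mul1r.
  rewrite -[leLHS]ger0_norm ?exprn_ge0 // -sqrtr_sqr ler_wsqrtr // -exprM -natrX ler_nat.
  by rewrite mul1n in jn8.
have b2 : bias n ^+ 2 = j%:R ^+ 8 / n%:R.
  by rewrite biasE exprMn exprVn sqr_sqrtr ?ler0n // -exprM.
have b0 : 0 < bias n by rewrite biasE divr_gt0 ?exprn_gt0.
have NU : N <= n%:R ^+ 4 by rewrite -natrX ler_nat num_copies_le.
have NL : (n%:R / 8) ^+ 4 <= N.
  apply: (@le_trans _ _ ((n %/ 4) ^ 4)%:R); last by rewrite ler_nat num_copies_ge.
  rewrite natrX; apply: lerXn2r; rewrite ?nnegrE ?divr_ge0 //.
  rewrite ler_pdivrMr // -natrM ler_nat; exact: n8.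
have coeffE : C4_coeff (slow n ^ 5).-1 (bias n) = j%:R / (8 * n%:R ^+ 2).
  rewrite /C4_coeff blocksE (exprM _ 2 2) b2 natrM natrX.
  by field; rewrite !gt_eqF.
have gapE : gap C4 n = N * (j%:R / (8 * n%:R ^+ 2)).
  rewrite gapE ?card_edges_C4 // -coeffE; exact: planted_mean_C4.
have std_le : std C4 n <= 2 * n%:R ^+ 2.
  have le_sq (v : R) : v <= 2 * n%:R ^+ 4 -> Num.sqrt v <= 2 * n%:R ^+ 2.
    move=> hv; rewrite -[leRHS]ger0_norm ?mulr_ge0 ?exprn_ge0 // -sqrtr_sqr; apply: ler_wsqrtr.
    apply: (le_trans hv); rewrite exprMn -exprM ler_wpM2r ?exprn_ge0 //.
    by rewrite expr2 -natrM ler_nat.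
  rewrite /std /max_std ge_max; apply/andP; split; apply: le_sq.
    rewrite null_var_eq ?card_edges_C4 //; last first.
      by move=> i; exact: connected_neighbor C4_connected _.
    apply: (le_trans NU); rewrite ler_peMl ?exprn_ge0 //; by rewrite ler1n.
  apply: (le_trans (planted_var_C4 _ _ _ b0)).
  rewrite [leRHS]mulrC; apply: ler_pM; [exact: ler0n| |exact: NU|].
    apply: addr_ge0 => //; apply: mulr_ge0; first by rewrite exprn_ge0 ?ltW.
    by rewrite exprn_ge0 // addr_ge0 // mulr_ge0 // invr_ge0 exprn_ge0 // ltW.
  rewrite -[leRHS]/(1 + 1); apply: lerD => //.
  apply: (@le_trans _ _ ((j%:R ^+ 8 / n%:R) ^+ 5 * (5 * n%:R) ^+ 4)).
    rewrite (exprM _ 2 5) b2; apply: ler_wpM2l.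
      by rewrite exprn_ge0 ?divr_ge0 ?exprn_ge0.
    apply: lerXn2r; rewrite ?nnegrE ?addr_ge0 ?mulr_ge0 ?invr_ge0 ?divr_ge0 ?exprn_ge0 //.
    (* The left side is [bias n] to the power [-2], so the base [4 * q ^- 2 + n] of the variance
       bound is at most [5 * n]. *)
    have : n%:R / j%:R ^+ 8 <= n%:R :> R.
      by rewrite ler_pdivrMr ?exprn_gt0 // ler_peMr // exprn_ege1.
    rewrite invf_div; lra.
  have -> : (j%:R ^+ 8 / n%:R) ^+ 5 * (5 * n%:R) ^+ 4 = 625 * j%:R ^+ 40 / n%:R :> R.
    by field; rewrite gt_eqF.
  rewrite ler_pdivrMr // mul1r -natrX -natrM ler_nat.
  exact: jn40.
change (C * std C4 n < `|gap C4 n|).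
apply: (@le_lt_trans _ _ (C * (2 * n%:R ^+ 2))); first by rewrite ler_wpM2l // ltW.
apply: (@lt_le_trans _ _ ((n%:R / 8) ^+ 4 * (j%:R / (8 * n%:R ^+ 2)))); last first.
  apply: le_trans (ler_norm _); rewrite gapE; apply: ler_wpM2r; last exact: NL.
  by rewrite divr_ge0 ?mulr_ge0 ?exprn_ge0.
have Cj : 4 * 8 ^+ 5 * C <= j%:R.
  by rewrite -[leRHS]invrK -[leLHS]invrK lef_pV2 // posrE invr_gt0.
have -> : (n%:R / 8) ^+ 4 * (j%:R / (8 * n%:R ^+ 2)) = n%:R ^+ 2 * (j%:R / 8 ^+ 5) :> R.
  by field; rewrite gt_eqF.
rewrite [ltLHS]mulrA [ltRHS]mulrC ltr_pM2r ?exprn_gt0 // ltr_pdivlMr ?exprn_gt0 //.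
apply: lt_le_trans Cj; have x0 : 0 < 8 ^+ 5 :> R by exact: exprn_gt0.
have := mulr_gt0 C0 x0; move: (8 ^+ 5) => x; lra.
Unshelve. all: by end_near. Qed.
Lemma fails_of_fourier0 m (H : sgraph m) : (0 < #|edges H|)%N ->
  (forall n (f : {ffun 'I_m -> 'I_n}), injective f -> fourier (model n) H f = 0) ->
  fails_to_distinguish (fun n => @sbm_pmf R (model n) n) H.
Proof.
move=> E0 z; apply: (@fails_of_fourier_le _ _ (fun=> 0)) => //.
  by move=> n f fi; rewrite z // normr0.
by near=> n; rewrite mulr0 invr_ge0 ler0n.
Unshelve. all: by end_near. Qed.

Lemma fails_unless_C4 m (H : sgraph m) :
  connected_graph H -> (0 < #|edges H|)%N -> ~ isomorphic H C4 ->
  fails_to_distinguish (fun n => @sbm_pmf R (model n) n) H.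
Proof.
move=> cH E0 notC4.
have [leaf|noleaf] := pselect (has_leaf H).
  by apply: fails_of_fourier0 => // n f fi; exact: fourier_leaf.
have [oddH|evenH] := boolP (odd #|edges H|).
  by apply: fails_of_fourier0 => // n f fi; exact: fourier_odd.
have d2 := deg_ge2 cH E0 noleaf.
have := edges_ge d2; rewrite leq_eqVlt => /orP[/eqP Em|]; last exact: fails_excess_edges.
have [m6|m6] := leqP 6 m; first exact: fails_unicyclic.
(* A vertex of degree at least 2 forces [m >= 3]; with [m < 6] and [m] even, only 4 is left. *)
have m4 : m = 4%N.
  have [m0 _] := cH; have := d2 (Ordinal m0); have := deg_lt H (Ordinal m0).
  by move: evenH m6; rewrite -Em; move: (deg H _) => d; lia.
subst m; case: notC4; apply: two_regular_iso_C4; exact: deg_eq2.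
Qed.
End Main.

Theorem theoremA6 (R : realType) :
  exists M : nat -> sbm R,
    [/\ forall n m (H : sgraph m) N (f : 'I_m -> 'I_N),
          has_leaf H -> injective f -> fourier (M n) H f = 0%R,
        forall n m (H : sgraph m) N (f : 'I_m -> 'I_N),
          odd #|edges H| -> injective f -> fourier (M n) H f = 0%R,
        distinguishes (fun n => @sbm_pmf R (M n) n) C4 &
        forall m (H : sgraph m),
          connected_graph H -> (0 < #|edges H|)%N -> ~ isomorphic H C4 ->
          fails_to_distinguish (fun n => @sbm_pmf R (M n) n) H].
Proof.
exists (@model R); split.
- by move=> n m H N f leaf fi; exact: fourier_leaf.
- by move=> n m H N f oddH fi; exact: fourier_odd.
- exact: C4_distinguishes.
- exact: fails_unless_C4.
Qed.
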